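(* Let $G$ be an infinite $R$-analytic profinite group of dimension $d$. Then \[ \operatorname{Spec}_R(G)\subseteq\Big\{0,\frac1d,\ldots,\frac{d-1}{d},1\Big\}. \] In particular, the $R$-analytic spectrum $\operatorname{Spec}_R(G)$ of $G$ is finite and consists of rational numbers.
   Context: Throughout, $R$ is a pro-$p$ ring, i.e. a commutative Noetherian complete local ring with maximal ideal $\mathfrak m$ and finite residue field $R/\mathfrak m$ of characteristic $p$, and its associated graded ring $\bigoplus_{n\ge 0}\mathfrak m^n/\mathfrak m^{n+1}$ is assumed to be an integral domain. Hence $R$ is an integral domain; $K$ denotes its field of fractions. $X^{(d)}$ denotes the cartesian product of $d$ copies of a set $X$. $R$-analytic manifolds and groups (in the sense of Dixon, du Sautoy, Mann, Segal, ''Analytic pro-$p$ groups'', Chapter 13). Put $|0|=0$ and $|x|=c^{-n}$ for $x\in\mathfrak m^n\smallsetminus\mathfrak m^{n+1}$ ($c>1$ fixed); this extends to an absolute value on $K$. A function from an open subset $V$ of $R^{(r)}$ to $R^{(s)}$ is analytic if near each point $y\in V$, i.e. on $y+(\mathfrak m^{\ell})^{(r)}$ for some $\ell$, its components are given by formal power series over $K$ in the coordinates of $x-y$ that converge there. An $R$-analytic manifold of dimension $d$ is a topological space with a full (maximal) atlas of charts $(U,\phi)$, $\phi$ a homeomorphism of the open set $U$ onto an open subset of $R^{(d)}$, with analytic transition functions. An $R$-analytic group is a topological group that is an $R$-analytic manifold with analytic multiplication and inversion; its dimension is its dimension as an analytic manifold. An $R$-analytic profinite group is an $R$-analytic group that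 is profinite as a topological group. An $R$-analytic subgroup $H$ of $G$ ($\dim G=d$) is a subgroup that is also an analytic submanifold in Serre's sense: for every $x\in H$ there are a chart $(V,\phi)$ of $G$ at $x$ with $\phi(x)=0$ and a vector subspace $E$ of $K^{(d)}$ with $\phi(H\cap V)=E\cap\phi(V)$. Such an $H$ is closed in $G$. Standard groups. An $R$-standard group $(S,\phi)$ of level $N\ge 1$ is an $R$-analytic group $S$ with a global chart given by a homeomorphism $\phi:S\to(\mathfrak m^N)^{(d)}$ such that $\phi(1)=0$ and there are power series $F_1,\dots,F_d\in R[[X,Y]]$ ($X,Y$ being $d$-tuples of indeterminates) without constant term such that $\phi(xy)=F(\phi(x),\phi(y))$ for all $x,y\in S$, where $F=(F_1,\dots,F_d)$. An open standard subgroup of $G$ is an open subgroup $S$ with a chart $(S,\phi)$ of $G$ making it an $R$-standard group; every $R$-analytic group contains one. Put $\mathfrak m^n_\phi S=\phi^{-1}((\mathfrak m^{N+n})^{(d)})$ for $n\ge 0$. These are open subgroups of $G$, and $\{\mathfrak m^n_\phi S\}_{n}$ is a filtration of $G$, the natural filtration of $G$ induced by $S$. Hausdorff dimension. A filtration of a countably based infinite profinite group $G$ is a descending series $\{G_n\}$ of open subgroups of $G$ forming a base of neighbourhoods of $1$. It defines the metric $d(x,y)=\inf\{|G:G_n|^{-1}\mid xy^{-1}\in G_n\}$ (with $d(x,y)=1$ if $xy^{-1}$ lies in no $G_n$), and $\operatorname{hDim}_{\{G_n\}}(X)$ is the Hausdorff dimension of $X\subseteq G$ with respect to this metric. $R$-analytic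 profinite groups are countably based. The standard Hausdorff dimension $\operatorname{hDim}_{\mathrm{Std}}(H)$ of a closed subgroup $H$ is $\operatorname{hDim}_{\{\mathfrak m^n_\phi S\}}(H)$ for any open standard subgroup $(S,\phi)$ of $G$; this does not depend on the choice of $(S,\phi)$. The $R$-analytic spectrum of $G$ is $\operatorname{Spec}_R(G)=\{\operatorname{hDim}_{\mathrm{Std}}(H)\mid H \text{ is an } R\text{-analytic subgroup of } G\}$. *)

(* Defs.v *)
From HB Require Import structures.
From mathcomp Require Import all_boot all_order all_algebra finmap.
From mathcomp Require Import all_classical all_reals all_analysis.

Set Implicit Arguments.
Unset Strict Implicit.
Unset Printing Implicit Defensive.

Import Order.TTheory GRing.Theory Num.Theory.

Local Open Scope classical_set_scope.
Local Open Scope ring_scope.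

(** * Pro-p rings

    [R : idomainType] is the coefficient ring and [m : set R] its maximal
    ideal. That [R] is a domain is a consequence of [graded_domain] below; it is
    built into the type so that the library's [{fraction R}] applies.  The real
    numbers are an arbitrary [realType], called [RR]. *)

Section Ideals.
Variable R : idomainType.
Implicit Types (I J m : set R).

Definition is_ideal I :=
  [/\ I 0, (forall x y, I x -> I y -> I (x + y)) & (forall a x, I x -> I (a * x))].

Definition ideal_gen (s : seq R) : set R :=
  [set x | forall J, is_ideal J -> (forall y, y \in s -> J y) -> J x].

Definition ideal_mul I J : set R :=
  [set x | exists2 s : seq (R * R), (forall u, u \in s -> I u.1 /\ J u.2) &
           x = \sum_(u <- s) u.1 * u.2].

Definition ideal_pow I (n : nat) : set R := iter n (ideal_mul I) setT.

Definition maximal_ideal I :=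
  [/\ is_ideal I, I <> setT &
      forall J, is_ideal J -> I `<=` J -> J = I \/ J = setT].

Definition noetherian :=
  forall I, is_ideal I -> exists s : seq R, I = ideal_gen s.

Definition local_ring m := maximal_ideal m /\ (forall J, maximal_ideal J -> J = m).

Definition adic_cauchy m (u : nat -> R) :=
  forall n, exists k, forall i j, (k <= i)%N -> (k <= j)%N -> ideal_pow m n (u i - u j).

Definition adic_limit m (u : nat -> R) (l : R) :=
  forall n, exists k, forall i, (k <= i)%N -> ideal_pow m n (u i - l).

Definition adic_complete m :=
  (forall x, (forall n, ideal_pow m n x) -> x = 0) /\
  (forall u, adic_cauchy m u -> exists l, adic_limit m u l).

(* The underlying set of R / I, as a set of cosets. *)
Definition residues I : set (set R) :=
  [set [set y | I (y - x)] | x in [set: R]].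

Definition pro_p_ring (p : nat) m :=
  [/\ noetherian, local_ring m, adic_complete m, finite_set (residues m) &
      prime p /\ m p%:R].

(* The associated graded ring is the quotient of the Rees algebra
   R[mT] = {f in R[T] | f_n in m^n} by its ideal {f | f_n in m^(n+1)}. *)
Definition rees m : set {poly R} := [set f | forall n, ideal_pow m n f`_n].

Definition rees_ker m : set {poly R} := [set f | forall n, ideal_pow m n.+1 f`_n].

(* gr R is a domain: 1 <> 0, and a product vanishes only if a factor does. *)
Definition graded_domain m :=
  ~ rees_ker m 1 /\
  (forall f g, rees m f -> rees m g -> rees_ker m (f * g) ->
     rees_ker m f \/ rees_ker m g).

(* (m^n)^(d) inside R^(d), and open sets of R^(d). *)
Definition polydisc m d (n : nat) : set 'rV[R]_d :=
  [set x | forall i, ideal_pow m n (x 0 i)].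

Definition adic_open m d (U : set 'rV[R]_d) :=
  forall x, U x -> exists n, forall h, polydisc m n h -> U (x + h).

End Ideals.

(** * Absolute value, power series and analytic functions *)

Section Analytic.
Variables (RR : realType) (R : idomainType) (c : RR) (m : set R).
Local Notation K := {fraction R}.

(* The n with x in m^n \ m^(n+1); meaningful for x != 0 only. *)
Definition adic_ord (x : R) : nat :=
  xget 0%N [set n | ideal_pow m n x /\ ~ ideal_pow m n.+1 x].

Definition ring_abs (x : R) : RR := if x == 0 then 0 else c ^- adic_ord x.

(* |a / b| = |a| / |b|, read off a representing pair (a, b) of x. *)
Definition frac_abs (x : K) : RR :=
  let ab := frac (generic_quotient.repr x) in ring_abs ab.1 / ring_abs ab.2.

Definition to_frac d (x : 'rV[R]_d) : 'rV[K]_d := map_mx (@tofrac R) x.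

(* A formal power series in r indeterminates is its family of coefficients. *)
Definition mindex r := {ffun 'I_r -> nat}.
Definition pseries (T : Type) r := mindex r -> T.

Definition monomial r (a : mindex r) (x : 'rV[K]_r) : K :=
  \prod_(i < r) x 0 i ^+ a i.

(* The series F converges at x, with sum l. *)
Definition pseries_sum r (F : pseries K r) (x : 'rV[K]_r) (l : K) :=
  forall e : RR, 0 < e -> exists J0 : {fset mindex r},
    forall J : {fset mindex r}, (J0 `<=` J)%fset ->
      frac_abs (\sum_(a <- J) F a * monomial a x - l) < e.

Definition analytic_on r s (V : set 'rV[R]_r) (f : 'rV[R]_r -> 'rV[R]_s) :=
  forall y, V y -> exists l, exists F : 'I_s -> pseries K r,
    forall h, polydisc m l h ->
      V (y + h) /\
      forall i, pseries_sum (F i) (to_frac h) (tofrac (f (y + h) 0 i)).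

(** * Manifolds *)

(* Only the values of [chart_map] on [chart_dom] are relevant. *)
Record chart (X : Type) d := Chart {
  chart_dom : set X;
  chart_map : X -> 'rV[R]_d }.

(* A homeomorphism from an open set onto an open set: a bijection between them
   matching their open subsets. *)
Definition is_chart (X : topologicalType) d (u : chart X d) :=
  [/\ open (chart_dom u),
      adic_open m (chart_map u @` chart_dom u),
      set_inj (chart_dom u) (chart_map u) &
      forall W, W `<=` chart_dom u ->
        (open W <-> adic_open m (chart_map u @` W))].

(* psi o f o phi^-1 is analytic on phi (U `&` f^-1 V), for charts (U, phi) and
   (V, psi); [t] is any total function agreeing with it there. *)
Definition analytic_in_charts (X Y : Type) r s (u : chart X r) (v : chart Y s)
    (f : X -> Y) :=
  let D := chart_dom u `&` f @^-1` chart_dom v in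
  exists t : 'rV[R]_r -> 'rV[R]_s,
    analytic_on (chart_map u @` D) t /\
    (forall x, D x -> t (chart_map u x) = chart_map v (f x)).

Definition compatible (X : Type) d (u v : chart X d) :=
  analytic_in_charts u v id /\ analytic_in_charts v u id.

Definition full_atlas (X : topologicalType) d (A : set (chart X d)) :=
  [/\ forall u, A u -> is_chart u,
      forall x, exists2 u, A u & chart_dom u x,
      forall u v, A u -> A v -> compatible u v &
      forall u, is_chart u -> (forall v, A v -> compatible u v) -> A u].

Definition prod_chart (X Y : Type) r s (u : chart X r) (v : chart Y s) :
    chart (X * Y) (r + s) :=
  Chart (chart_dom u `*` chart_dom v)
        (fun z => row_mx (chart_map u z.1) (chart_map v z.2)).

Definition prod_atlas (X Y : Type) r s (A : set (chart X r)) (B : set (chart Y s)) :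
    set (chart (X * Y) (r + s)) :=
  [set w | exists u v, [/\ A u, B v & w = prod_chart u v]].

(* The atlases need not be full: analyticity can be tested on any atlas. *)
Definition analytic_map (X Y : topologicalType) r s
    (A : set (chart X r)) (B : set (chart Y s)) (f : X -> Y) :=
  continuous f /\ (forall u v, A u -> B v -> analytic_in_charts u v f).

End Analytic.

Arguments chart R X d : clear implicits.

(** * Topological and profinite groups *)

HB.mixin Record isTopologicalGroup G of Topological G & Group G := {
  mulg_continuous : continuous (fun z : G * G => (z.1 * z.2)%g);
  invg_continuous : continuous (fun x : G => x^-1%g) }.

#[short(type="topologicalGroupType")]
HB.structure Definition TopologicalGroup :=
  {G of isTopologicalGroup G & Topological G & Group G}.

Definition profinite_group (G : topologicalGroupType) :=
  [/\ compact [set: G], hausdorff_space G & totally_disconnected [set: G]].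

Definition is_subgroup (G : groupType) (H : set G) :=
  [/\ H 1%g, (forall x y, H x -> H y -> H (x * y)%g) & (forall x, H x -> H x^-1%g)].

(* |G : H|, the number of right cosets; only used when it is finite. *)
Definition index (G : groupType) (H : set G) : nat :=
  #|` fset_set [set [set (h * x)%g | h in H] | x in [set: G]]|%fset.

(** * Hausdorff dimension *)

Section Hausdorff.
Variable RR : realType.
Local Open Scope ereal_scope.

Definition diameter (T : Type) (dist : T -> T -> RR) (U : set T) : \bar RR :=
  maxe 0 (ereal_sup [set (dist z.1 z.2)%:E | z in U `*` U]).

(* The empty set contributes 0, also for s = 0. *)
Definition cover_cost (T : Type) (dist : T -> T -> RR) (s : RR)
    (F : nat -> set T) : \bar RR :=
  \sum_(0 <= i <oo)
    (if F i == set0 then 0 else poweR (diameter dist (F i)) s).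

Definition hausdorff_premeasure (T : Type) (dist : T -> T -> RR) (s e : RR)
    (X : set T) : \bar RR :=
  ereal_inf [set cover_cost dist s F | F in
    [set F : nat -> set T | X `<=` \bigcup_i F i /\
                            forall i, diameter dist (F i) <= e%:E]].

Definition hausdorff_measure (T : Type) (dist : T -> T -> RR) (s : RR)
    (X : set T) : \bar RR :=
  ereal_sup [set hausdorff_premeasure dist s e X | e in [set e : RR | (0 < e)%R]].

Definition hausdorff_dim (T : Type) (dist : T -> T -> RR) (X : set T) : \bar RR :=
  ereal_inf [set s%:E | s in
    [set s : RR | (0 <= s)%R /\ hausdorff_measure dist s X = 0]].

Local Close Scope ereal_scope.

Definition filtration_dist (G : groupType) (Gn : nat -> set G) (x y : G) : RR :=
  if `[< exists n, Gn n (x * y^-1)%g >]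
  then inf [set (index (Gn n))%:R^-1 | n in [set n | Gn n (x * y^-1)%g]]
  else 1.

Definition hDim (G : groupType) (Gn : nat -> set G) (X : set G) : \bar RR :=
  hausdorff_dim (filtration_dist Gn) X.

End Hausdorff.

(** * Analytic groups and their spectrum *)

Section AnalyticGroups.
Variables (RR : realType) (R : idomainType) (c : RR) (m : set R).
Variables (d : nat) (G : topologicalGroupType) (A : set (chart R G d)).

Definition analytic_group :=
  [/\ full_atlas c m A,
      analytic_map c m (prod_atlas A A) A (fun z : G * G => (z.1 * z.2)%g) &
      analytic_map c m A A (fun x : G => x^-1%g)].

Definition analytic_subgroup (H : set G) :=
  is_subgroup H /\
  forall x, H x -> exists (u : chart R G d) (E : {vspace 'rV[{fraction R}]_d}),
    [/\ A u, chart_dom u x, chart_map u x = 0 &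
        chart_map u @` (H `&` chart_dom u) =
        [set y | to_frac y \in E] `&` chart_map u @` chart_dom u].

(* The open subgroup S is the domain of [u], of level N. *)
Definition open_standard_subgroup (N : nat) (u : chart R G d) :=
  [/\ (1 <= N)%N, A u, is_subgroup (chart_dom u) /\ open (chart_dom u),
      chart_map u @` chart_dom u = polydisc m N /\ chart_map u 1%g = 0 &
      exists F : 'I_d -> pseries R (d + d),
        (forall i, F i [ffun=> 0%N] = 0) /\
        forall x y, chart_dom u x -> chart_dom u y -> forall i,
          pseries_sum c m (fun a => tofrac (F i a))
            (to_frac (row_mx (chart_map u x) (chart_map u y)))
            (tofrac (chart_map u (x * y)%g 0 i))].

Definition natural_filtration (N : nat) (u : chart R G d) (n : nat) : set G :=
  chart_dom u `&` chart_map u @^-1` polydisc m (N + n).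

(* h is the Hausdorff dimension of H with respect to the natural filtration
   induced by some open standard subgroup (any two of them give the same h). *)
Definition is_hDimStd (H : set G) (h : \bar RR) :=
  exists (N : nat) (u : chart R G d),
    open_standard_subgroup N u /\ h = hDim RR (natural_filtration N u) H.

Definition analytic_spectrum : set (\bar RR) :=
  [set h | exists2 H, analytic_subgroup H & is_hDimStd H h].

End AnalyticGroups.

(* Main.v *)
(* Let E be the subspace cutting out an analytic subgroup H near 1; then
   hDim H = dim E / d. Write q^(l n) = |R / m^n|. An analytic change of charts is
   bi-Lipschitz near 1, and E is parametrized by dim E of the coordinates up to a
   fixed denominator b, whose multiplication shifts the m-adic filtration by
   exactly ord b because gr R is a domain. Hence |H : H /\ S_n| agrees with
   q^(dim E * l n) and |G : S_n| with q^(d * l n), up to a bounded shift of n and a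
   constant factor. The shift is harmless since l (n + t) / l n -> 1: the standard
   monomials of gr R are closed under divisors, and double counting gives
   (n + 1) mu_(n+1) <= (n + s) mu_n for mu_n = l (n + 1) - l n, where s is the
   number of generators of m. Covering H by cosets of S_n bounds hDim H from above;
   from below, compactness reduces any cover to finitely many cosets of the S_(n_i),
   and counting cosets of a smaller S_n gives sum_i 1 / |H : H /\ S_(n_i)| >= 1. *)

Require Import Defs.
From HB Require Import structures.
From mathcomp Require Import all_boot all_order all_algebra finmap.
From mathcomp Require Import ring lra zify.
From mathcomp Require Import all_classical all_reals all_analysis.

Set Implicit Arguments.
Unset Strict Implicit.
Unset Printing Implicit Defensive.

Import Order.TTheory GRing.Theory Num.Theory.

Local Open Scope classical_set_scope.
Local Open Scope ring_scope.

(** * Counting classes *)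

(** Hilbert polynomials are avoided: the inequality between consecutive [mu] is an equality for a
    polynomial ring in s variables, where mu_n is the binomial coefficient of n + s - 1 over s - 1,
    and it already controls the growth of [l]. The maps along which H is counted (changes of charts,
    projection to some coordinates, multiplication by b) are neither homomorphisms nor bijections.
    Indices are therefore treated as numbers of classes of a relation, and each comparison is made
    by an inequality in one direction. The denominator b comes from R not being principal in
    general: the lattice of integral points of E need not be free, and it is only enclosed between
    two free lattices. Infiniteness of G excludes d = 0 and m = 0. *)

Section Transversals.
Variable T : Type.
Implicit Types (E : T -> T -> Prop) (X : set T).

(** A transversal replaces the quotient of [X] by [E], so that classes can be counted along maps
    between the sets themselves, compatible with the relations in one direction only. *)
Definition representatives E X (I : finType) (t : I -> T) :=
  [/\ forall i, X (t i), forall i j, E (t i) (t j) -> i = j &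
      forall x, X x -> exists i, E x (t i)].

Definition nclasses E X (n : nat) := exists t : 'I_n -> T, representatives E X t.

Lemma nclasses_representatives E X (I : finType) (t : I -> T) :
  representatives E X t -> nclasses E X #|I|.
Proof.
case=> tX tI tS; exists (t \o enum_val); split => //=.
  by move=> i j /tI /enum_val_inj.
by move=> x /tS[i xi]; exists (enum_rank i); rewrite enum_rankK.
Qed.

End Transversals.

(** It is enough that [f] reflects the relations: sending a representative to the class of its image
    is then injective. *)
Lemma nclasses_le (T T' : Type) (E : T -> T -> Prop) (E' : T' -> T' -> Prop)
    (X : set T) (X' : set T') (f : T -> T') (a b : nat) :
  (forall x y, E' x y -> E' y x) -> (forall x y z, E' x y -> E' y z -> E' x z) ->
  (forall x, X x -> X' (f x)) ->
  (forall x y, X x -> X y -> E' (f x) (f y) -> E x y) ->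
  nclasses E X a -> nclasses E' X' b -> (a <= b)%N.
Proof.
move=> sym trans fX fE [t [tX tI _]] [t' [_ _ tS']].
have /choice[g gP] i : exists j, E' (f (t i)) (t' j) by exact/tS'/fX.
have : injective g.
  move=> i j gij; apply: tI; apply: fE => //.
  by apply: trans (gP i) _; rewrite gij; apply: sym.
by move/leq_card; rewrite !card_ord.
Qed.

Lemma nclasses_uniq (T : Type) (E : T -> T -> Prop) (X : set T) (a b : nat) :
  (forall x y, E x y -> E y x) -> (forall x y z, E x y -> E y z -> E x z) ->
  nclasses E X a -> nclasses E X b -> a = b.
Proof.
move=> sym trans Xa Xb; apply/eqP; rewrite eqn_leq.
by apply/andP; split;
  [apply: (nclasses_le (f := id) sym trans _ _ Xa Xb) |
   apply: (nclasses_le (f := id) sym trans _ _ Xb Xa)].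
Qed.

(** A largest [E]-separated family is a transversal, because a point related to none of its members
    could be added. The map [f] bounds the size of such families by [b], so a largest one exists. *)
Lemma nclasses_exists (T T' : Type) (E : T -> T -> Prop) (E' : T' -> T' -> Prop)
    (X : set T) (X' : set T') (f : T -> T') (b : nat) :
  (forall x, E x x) -> (forall x y, E x y -> E y x) ->
  (forall x y, E' x y -> E' y x) -> (forall x y z, E' x y -> E' y z -> E' x z) ->
  (forall x, X x -> X' (f x)) ->
  (forall x y, X x -> X y -> E' (f x) (f y) -> E x y) ->
  nclasses E' X' b -> exists2 a, nclasses E X a & (a <= b)%N.
Proof.
move=> refl sym sym' trans' fX fE [t' [_ _ tS']].
pose sep k := exists2 t : 'I_k -> T, (forall i, X (t i)) &
  forall i j, E (t i) (t j) -> i = j.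
have sep_le k : `[< sep k >] -> (k <= b)%N.
  move=> /asboolP[t tX tI].
  have /choice[g gP] i : exists j, E' (f (t i)) (t' j) by exact/tS'/fX.
  have : injective g.
    move=> i j gij; apply: tI; apply: fE => //.
    by apply: trans' (gP i) _; rewrite gij; apply: sym'.
  by move/leq_card; rewrite !card_ord.
have sep0 : exists k, `[< sep k >].
  exists 0%N; apply/asboolP.
  by exists (fun i : 'I_0 => False_rect T (notF (ltn_ord i))) => [[]|[]].
case: (ex_maxnP sep0 sep_le) => k /asboolP[t tX tI] kmax.
exists k; last by apply/sep_le/asboolP; exists t.
exists t; split => // x Xx; apply: contrapT => nx.
suff /kmax : `[< sep k.+1 >] by rewrite ltnn.
apply/asboolP.
pose s (i : 'I_k.+1) := if unlift ord0 i is Some j then t j else x.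
exists s => [i|i j]; rewrite /s.
  by case: unliftP.
case: (unliftP ord0 i) => [i' ->|->]; case: (unliftP ord0 j) => [j' ->|->] //.
- by move/tI => ->.
- by move=> /sym h; case: nx; exists i'.
- by move=> h; case: nx; exists j'.
Qed.

Lemma nclasses_subset (T : Type) (E : T -> T -> Prop) (X Y : set T) (b : nat) :
  (forall x, E x x) -> (forall x y, E x y -> E y x) ->
  (forall x y z, E x y -> E y z -> E x z) ->
  X `<=` Y -> nclasses E Y b -> exists2 a, nclasses E X a & (a <= b)%N.
Proof. by move=> r s t XY Yb; apply: (nclasses_exists (f := id) r s s t XY _ Yb). Qed.

Lemma nclasses_row (T : Type) (E : T -> T -> Prop) (X : set T) (n e : nat) :
  nclasses E X n ->
  nclasses (fun x y : 'rV[T]_e => forall i, E (x 0 i) (y 0 i))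
           [set x | forall i, X (x 0 i)] (n ^ e).
Proof.
case=> t [tX tI tS].
rewrite -[n in (n ^ e)%N]card_ord -[e in (_ ^ e)%N]card_ord -card_ffun.
apply: (@nclasses_representatives _ _ _ _
  (fun f : {ffun 'I_e -> 'I_n} => \row_i t (f i))); split.
- by move=> f i /=; rewrite mxE.
- by move=> f g fg; apply/ffunP => i; apply: tI; move: (fg i); rewrite !mxE.
- move=> x Xx; have /choice[g gP] i : exists j, E (x 0 i) (t j) by exact/tS/Xx.
  by exists [ffun i => g i] => i; rewrite mxE ffunE.
Qed.

Lemma nclasses_mul (T : Type) (E E' : T -> T -> Prop) (X : set T) (a b : nat) :
  (forall x y, E' x y -> E' y x) -> (forall x y z, E' x y -> E' y z -> E' x z) ->
  (forall x y, E x y -> E' x y) -> nclasses E' X a ->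
  (forall x, X x -> nclasses E (X `&` [set y | E' y x]) b) ->
  nclasses E X (a * b).
Proof.
move=> sym trans EE' [t [tX tI tS]] h.
have /choice[s sP] i := h _ (tX i).
rewrite -[a]card_ord -[b]card_ord -card_prod.
apply: (@nclasses_representatives _ _ _ _ (fun z : 'I_a * 'I_b => s z.1 z.2)).
split => [[i j]|[i j] [i' j'] /= Eij|x Xx].
- by have [/(_ j)[]] := sP i.
- have ii' : i = i'.
    apply: tI; have [/(_ j)[_ /= h1] _ _] := sP i.
    have [/(_ j')[_ /= h2] _ _] := sP i'.
    by apply: trans (sym _ _ h1) (trans _ _ _ (EE' _ _ Eij) h2).
  move: Eij; rewrite -ii' => Eij; congr pair.
  by have [_ + _] := sP i; apply.
- have [i xi] := tS _ Xx; have [_ _ /(_ x)[//|j xj]] := sP i.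
  by exists (i, j).
Qed.

Section Cosets.
Variables (G : groupType) (H : set G).
Hypothesis sgH : is_subgroup H.

Definition coset_eq (S : set G) (x y : G) := S (x * y^-1)%g.

Lemma coset_eq_refl x : coset_eq H x x.
Proof. by case: sgH => h1 _ _; rewrite /coset_eq mulgV. Qed.

Lemma coset_eq_sym x y : coset_eq H x y -> coset_eq H y x.
Proof. by case: sgH => _ _ hV /hV; rewrite /coset_eq invgM invgK. Qed.

Lemma coset_eq_trans x y z : coset_eq H x y -> coset_eq H y z -> coset_eq H x z.
Proof.
case: sgH => _ hM _ xy yz; rewrite /coset_eq.
by have := hM _ _ xy yz; rewrite mulgA mulgVK.
Qed.

Lemma nclasses_index n : nclasses (coset_eq H) [set: G] n -> Defs.index H = n.
Proof.
case: sgH => H1 HM HV [t [_ tI tS]].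
pose f x := [set (h * x)%g | h in H].
have ff x y : f x = f y <-> coset_eq H x y.
  split => [fxy|xy].
    have : f y x by rewrite -fxy; exists 1%g => //; rewrite mul1g.
    by case=> h Hh <-; rewrite /coset_eq mulgK.
  apply/seteqP; split => z [h Hh <-].
    exists (h * (x * y^-1))%g; first exact: HM.
    by rewrite -!mulgA mulVg mulg1.
  exists (h * (y * x^-1))%g; last by rewrite -!mulgA mulVg mulg1.
  exact/HM/coset_eq_sym.
rewrite /Defs.index; apply: card_fset_set.
rewrite (_ : [set f x | x in _] = (f \o t) @` [set: 'I_n]); last first.
  apply/seteqP; split => [_ [x _ <-]|_ [i _ <-]]; last by exists (t i).
  by have [i /ff xi] := tS x I; exists i.
rewrite card_eq_sym (card_eq_trans card_II)// card_eq_sym.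
by apply: inj_card_eq => i j _ _ /= /ff /tI.
Qed.

(** Right translation by [x] preserves [coset_eq], so every [B]-coset in [H] splits into [C]-cosets
    as [B] itself does. *)
Lemma nclasses_coset_mul (B C : set G) (a b : nat) :
  is_subgroup B -> B `<=` H -> C `<=` B ->
  nclasses (coset_eq B) H a -> nclasses (coset_eq C) B b ->
  nclasses (coset_eq C) H (a * b).
Proof.
move=> sgB BH CB Ha [t [tB tI tS]].
have [B1 BM BV] := sgB; have [H1 HM HV] := sgH.
apply: (nclasses_mul (E' := coset_eq B)) Ha _.
- by move=> x y xy; have := BV _ xy; rewrite /coset_eq invgM invgK.
- move=> x y z xy yz; rewrite /coset_eq.
  by have := BM _ _ xy yz; rewrite mulgA mulgVK.
- by move=> x y /CB.
move=> x Hx; exists (fun j => t j * x)%g; split.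
- move=> j; split; first by apply: HM => //; exact: BH.
  by rewrite /= /coset_eq mulgK.
- by move=> i j; rewrite /coset_eq invgM mulgA mulgK => /tI.
- move=> y [Hy yx]; have [j yj] := tS _ yx; exists j.
  by rewrite /coset_eq invgM mulgA.
Qed.

End Cosets.

(** * The adic valuation *)

Section IdealPowers.
Variables (R : idomainType) (m : set R).
Hypothesis idm : is_ideal m.
Local Notation P := (ideal_pow m).

Lemma ideal_mul_ideal (I J : set R) : is_ideal I -> is_ideal (ideal_mul I J).
Proof.
move=> [I0 ID IM]; split.
- by exists [::] => //; rewrite big_nil.
- move=> x y [s sIJ ->] [t tIJ ->]; exists (s ++ t); last by rewrite big_cat.
  by move=> u; rewrite mem_cat => /orP[/sIJ|/tIJ].
- move=> a x [s sIJ ->]; exists [seq (a * u.1, u.2) | u <- s].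
    by move=> _ /mapP[v /sIJ[v1 v2] ->] /=; split => //; apply: IM.
  by rewrite big_map mulr_sumr; apply: eq_bigr => u _; rewrite mulrA.
Qed.

Lemma ideal_pow_ideal n : is_ideal (P n).
Proof. by case: n => [//|n]; apply: ideal_mul_ideal. Qed.

Lemma ideal_pow0 n : P n 0. Proof. by case: (ideal_pow_ideal n). Qed.

Lemma ideal_powD n x y : P n x -> P n y -> P n (x + y).
Proof. by case: (ideal_pow_ideal n) => _ + _; apply. Qed.

Lemma ideal_powMl n a x : P n x -> P n (a * x).
Proof. by case: (ideal_pow_ideal n) => _ _; apply. Qed.

Lemma ideal_powMr n a x : P n x -> P n (x * a).
Proof. by rewrite mulrC; exact: ideal_powMl. Qed.

Lemma ideal_powN n x : P n x -> P n (- x).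
Proof. by rewrite -mulN1r; exact: ideal_powMl. Qed.

Lemma ideal_powBC n x y : P n (x - y) -> P n (y - x).
Proof. by move=> /ideal_powN; rewrite opprB. Qed.

Lemma ideal_powB_trans n x y z : P n (x - y) -> P n (y - z) -> P n (x - z).
Proof. by move=> xy /(ideal_powD xy); rewrite addrA subrK. Qed.

Lemma ideal_pow_sum n (I : Type) (r : seq I) (Q : pred I) (F : I -> R) :
  (forall i, Q i -> P n (F i)) -> P n (\sum_(i <- r | Q i) F i).
Proof.
move=> h; elim/big_ind: _ => //; first exact: ideal_pow0.
exact: ideal_powD.
Qed.

Lemma ideal_powM i j x y : P i x -> P j y -> P (i + j) (x * y).
Proof.
elim: i x => [|i IHi] x; first by move=> _; exact: ideal_powMl.
move=> [s sP ->] Py; rewrite mulr_suml addSn.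
exists [seq (u.1, u.2 * y) | u <- s].
  by move=> _ /mapP[u /sP[u1 u2] ->] /=; split => //; apply: IHi.
by rewrite big_map; apply: eq_bigr => u _; rewrite mulrA.
Qed.

Lemma ideal_powS i x : P i.+1 x -> P i x.
Proof.
move=> [s sP ->]; rewrite big_seq; apply: ideal_pow_sum => u /sP[_ ?].
exact: ideal_powMl.
Qed.

Lemma ideal_pow_le i j x : (i <= j)%N -> P j x -> P i x.
Proof. by move=> /subnK <-; elim: (j - i)%N => //= k IHk /ideal_powS. Qed.

Lemma ideal_pow1 x : P 1 x <-> m x.
Proof.
case: (idm) => m0 mD mM; split => [[s sP ->]|mx].
  rewrite big_seq; elim/big_ind: _ => // u /sP[mu _].
  by rewrite mulrC; apply: mM.
by exists [:: (x, 1)] => [u|]; rewrite ?inE ?big_seq1 ?mulr1// => /eqP ->.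
Qed.

Lemma ideal_powX i x k : P i x -> P (i * k) (x ^+ k).
Proof.
move=> Px; elim: k => [|k IHk]; first by rewrite muln0.
by rewrite mulnS exprS; apply: ideal_powM.
Qed.

End IdealPowers.

Section Order.
Variables (R : idomainType) (m : set R).
Hypotheses (idm : is_ideal m) (sepm : forall x, (forall n, ideal_pow m n x) -> x = 0)
  (hgr : graded_domain m).
Local Notation P := (ideal_pow m).
Local Notation ord := (adic_ord m).

Lemma adic_ordP x : x != 0 -> P (ord x) x /\ ~ P (ord x).+1 x.
Proof.
move=> x0; rewrite /adic_ord; case: xgetP => [n _ //|h].
exfalso; move/eqP: x0; apply; apply: sepm; elim=> // n IHn.
by apply: contrapT => nx; apply: (h n).
Qed.

Lemma adic_ord_ge x n : x != 0 -> P n x <-> (n <= ord x)%N.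
Proof.
move=> /adic_ordP[h1 h2]; split => [Px|le]; last exact: ideal_pow_le le h1.
rewrite leqNgt; apply/negP => lt; apply: h2; exact: ideal_pow_le lt Px.
Qed.

Lemma adic_ord_eq x n : P n x -> ~ P n.+1 x -> ord x = n.
Proof.
move=> Pn nPn; have x0 : x != 0.
  by apply/eqP => x0; apply: nPn; rewrite x0; exact: ideal_pow0.
apply/eqP; rewrite eqn_leq; apply/andP; split; last exact/adic_ord_ge.
by rewrite leqNgt; apply/negP => /(adic_ord_ge _ x0).
Qed.

(** The initial forms of [x] and [y] are represented in the Rees algebra by the homogeneous elements
    x T^i and y T^j, whose product lives in degree i + j only. *)
Lemma ideal_powM_notin i j x y :
  P i x -> ~ P i.+1 x -> P j y -> ~ P j.+1 y -> ~ P (i + j).+1 (x * y).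
Proof.
move=> Pix nPix Pjy nPjy Pxy; case: hgr => _ h.
have rP k z : P k z -> rees m (z *: 'X^k).
  move=> Pz n; rewrite coefZ coefXn; case: eqP => [->|_].
    by rewrite mulr1.
  by rewrite mulr0; exact: ideal_pow0.
have kP k z : ~ P k.+1 z -> ~ rees_ker m (z *: 'X^k).
  by move=> nPz /(_ k); rewrite coefZ coefXn eqxx mulr1.
case: (h (x *: 'X^i) (y *: 'X^j)); try exact: rP; try exact: kP.
move=> n; rewrite -scalerAl -scalerAr scalerA -exprD coefZ coefXn.
by case: eqP => [->|_]; rewrite ?mulr1// mulr0; exact: ideal_pow0.
Qed.

Lemma adic_ordM x y : x != 0 -> y != 0 -> ord (x * y) = (ord x + ord y)%N.
Proof.
move=> /adic_ordP[x1 x2] /adic_ordP[y1 y2]; apply: adic_ord_eq.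
  exact: ideal_powM.
exact: ideal_powM_notin.
Qed.

(** Division by a fixed [d] costs exactly [ord d] levels; this is how the denominator of a subspace
    is cancelled later. *)
Lemma ideal_pow_divl d x n : d != 0 -> P (ord d + n) (d * x) -> P n x.
Proof.
move=> d0 Pdx; have [->|x0] := eqVneq x 0; first exact: ideal_pow0.
apply/adic_ord_ge => //; move/adic_ord_ge : Pdx; rewrite mulf_neq0//.
by rewrite adic_ordM// leq_add2l; apply.
Qed.

Lemma adic_ord1 : ord 1 = 0%N.
Proof.
apply: adic_ord_eq => //; case: hgr => + _ => h P11; apply: h => -[|n].
  by rewrite coef1.
by rewrite coef1; exact: ideal_pow0.
Qed.

End Order.

Section AbsoluteValue.
Variables (RR : realType) (c : RR) (R : idomainType) (m : set R).
Hypotheses (hc : 1 < c) (idm : is_ideal m)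
  (sepm : forall x, (forall n, ideal_pow m n x) -> x = 0) (hgr : graded_domain m).
Local Notation P := (ideal_pow m).
Local Notation K := {fraction R}.
Local Notation absR := (ring_abs c m).
Local Notation absK := (frac_abs c m).

Let c_gt0 : 0 < c. Proof. exact: lt_trans hc. Qed.

Lemma ring_abs0 : absR 0 = 0. Proof. by rewrite /ring_abs eqxx. Qed.

Lemma ring_abs_gt0 x : x != 0 -> 0 < absR x.
Proof. by move=> x0; rewrite /ring_abs (negbTE x0) invr_gt0 exprn_gt0. Qed.

Lemma ring_abs_ge0 x : 0 <= absR x.
Proof. by have [->|/ring_abs_gt0/ltW//] := eqVneq x 0; rewrite ring_abs0. Qed.

Lemma ring_absM x y : absR (x * y) = absR x * absR y.
Proof.
have [->|x0] := eqVneq x 0; first by rewrite mul0r ring_abs0 mul0r.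
have [->|y0] := eqVneq y 0; first by rewrite mulr0 ring_abs0 mulr0.
by rewrite /ring_abs mulf_eq0 (negbTE x0) (negbTE y0)/= adic_ordM// exprD invfM.
Qed.

Lemma ring_abs1 : absR 1 = 1.
Proof. by rewrite /ring_abs oner_eq0 adic_ord1// expr0 invr1. Qed.

Lemma ring_abs_le x n : absR x <= c ^- n <-> P n x.
Proof.
have [->|x0] := eqVneq x 0.
  rewrite ring_abs0; split => _; first exact: ideal_pow0.
  by rewrite invr_ge0 exprn_ge0// ltW.
rewrite /ring_abs (negbTE x0) lef_pV2 ?posrE ?exprn_gt0//.
by rewrite ler_eXn2l//; split=> /(adic_ord_ge idm sepm _ x0).
Qed.

Lemma ring_abs_max x y : absR (x + y) <= Num.max (absR x) (absR y).
Proof.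
wlog yx : x y / absR y <= absR x => [h|].
  have /orP[/h//|/h] := le_total (absR y) (absR x).
  by rewrite addrC maxC.
have [x0|x0] := eqVneq x 0; first by rewrite x0 add0r le_max lexx orbT.
rewrite le_max; apply/orP; left.
rewrite {2}/ring_abs (negbTE x0); apply/ring_abs_le/ideal_powD => //.
  by apply/ring_abs_le; rewrite /ring_abs (negbTE x0).
by apply/ring_abs_le; rewrite (le_trans yx)// /ring_abs (negbTE x0).
Qed.

Lemma repr_fraction (x : K) :
  x = tofrac (frac (generic_quotient.repr x)).1 /
      tofrac (frac (generic_quotient.repr x)).2.
Proof.
set ab := generic_quotient.repr x.
have ab0 : (frac ab).2 != 0 by exact: denom_ratioP.
have : x = (\pi_({fraction R}) (Ratio (frac ab).1 (frac ab).2))%qT.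
  by rewrite Ratio_numden generic_quotient.reprK.
move=> {1}->; apply: (canRL (mulfK _)); first by rewrite tofrac_eq0.
unlock tofrac; rewrite -[LHS]FracField.pi_mul /FracField.mulf.
rewrite !numden_Ratio ?oner_eq0// mulr1.
apply/generic_quotient.eqmodP; rewrite /= /FracField.equivf /=.
by rewrite !numden_Ratio ?mulr1 ?oner_eq0// mulrC.
Qed.

Lemma fraction_repr (x : K) : exists a b : R, b != 0 /\ x = tofrac a / tofrac b.
Proof. by do 2 eexists; split; last exact: repr_fraction; exact: denom_ratioP. Qed.

Lemma frac_absE (a b : R) : b != 0 ->
  absK (tofrac a / tofrac b) = absR a / absR b.
Proof.
move=> b0; rewrite /frac_abs; set x := tofrac a / _.
have := repr_fraction x; set ab := generic_quotient.repr x => xE.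
have ab0 : (frac ab).2 != 0 by exact: denom_ratioP.
have : a * (frac ab).2 = (frac ab).1 * b.
  apply/eqP; rewrite -tofrac_eq !tofracM; apply/eqP.
  by move/eqP: xE; rewrite /x eqr_div ?tofrac_eq0// => /eqP ->.
move=> /(congr1 absR); rewrite !ring_absM => h.
by apply/eqP; rewrite /= eqr_div ?lt0r_neq0 ?ring_abs_gt0// -h.
Qed.

Lemma frac_abs_tofrac a : absK (tofrac a) = absR a.
Proof.
have := @frac_absE a 1 (oner_neq0 _).
by rewrite tofrac1 divr1 ring_abs1 divr1.
Qed.

Lemma frac_absM x y : absK (x * y) = absK x * absK y.
Proof.
have [a [b [b0 ->]]] := fraction_repr x.
have [a' [b' [b0' ->]]] := fraction_repr y.
rewrite mulf_div -!tofracM !frac_absE ?mulf_neq0// !ring_absM.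
by rewrite mulf_div.
Qed.

Lemma frac_abs0 : absK 0 = 0.
Proof. by rewrite -tofrac0 frac_abs_tofrac ring_abs0. Qed.

Lemma frac_abs1 : absK 1 = 1.
Proof. by rewrite -tofrac1 frac_abs_tofrac ring_abs1. Qed.

Lemma frac_absX x n : absK (x ^+ n) = absK x ^+ n.
Proof.
by elim: n => [|n IHn]; rewrite ?expr0 ?frac_abs1// !exprS frac_absM IHn.
Qed.

Lemma frac_abs_ge0 x : 0 <= absK x.
Proof.
have [a [b [b0 ->]]] := fraction_repr x.
by rewrite frac_absE// divr_ge0 ?ring_abs_ge0.
Qed.

Lemma frac_abs_max x y : absK (x + y) <= Num.max (absK x) (absK y).
Proof.
have [a [b [b0 ->]]] := fraction_repr x.
have [a' [b' [b0' ->]]] := fraction_repr y.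
rewrite addf_div ?tofrac_eq0// -!tofracM -tofracD !frac_absE ?mulf_neq0//.
have bb' : 0 < absR (b * b') by rewrite ring_abs_gt0 ?mulf_neq0.
rewrite ler_pdivrMr// maxr_pMl ?ring_abs_ge0// (le_trans (ring_abs_max _ _))//.
have -> : absR (a * b') = absR a / absR b * absR (b * b').
  by rewrite !ring_absM mulrA divfK// gt_eqF// ring_abs_gt0.
have -> : absR (a' * b) = absR a' / absR b' * absR (b * b').
  by rewrite !ring_absM mulrCA divfK 1?mulrC// gt_eqF// ring_abs_gt0.
exact: lexx.
Qed.

Lemma frac_absN x : absK (- x) = absK x.
Proof.
have : absK (-1) ^+ 2 = 1 by rewrite -frac_absX sqrrN expr1n frac_abs1.
move/eqP; rewrite sqrf_eq1 => /orP[/eqP h|/eqP h].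
  by rewrite -mulN1r frac_absM h mul1r.
by have := frac_abs_ge0 (-1); rewrite h lerNr oppr0 lt_geF.
Qed.

Lemma frac_abs_le_add B x y : absK x <= B -> absK y <= B -> absK (x + y) <= B.
Proof. by move=> xB yB; rewrite (le_trans (frac_abs_max _ _))// ge_max xB. Qed.

Lemma frac_abs_le_sum B (I : Type) (r : seq I) (F : I -> K) : 0 <= B ->
  (forall i, absK (F i) <= B) -> absK (\sum_(i <- r) F i) <= B.
Proof.
move=> B0 h; elim/big_ind: _ => //; first by rewrite frac_abs0.
by move=> x y; exact: frac_abs_le_add.
Qed.

End AbsoluteValue.

Lemma exprn_unbounded (RR : realType) (c : RR) (B : RR) :
  1 < c -> exists w : nat, B <= c ^+ w.
Proof.
move=> c1; have [n hn] : exists n : nat, B <= 1 + (c - 1) *+ n.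
  have c0 : 0 < c - 1 by rewrite subr_gt0.
  exists (Num.truncn (`|B| / (c - 1))).+1.
  rewrite -mulr_natr (le_trans (ler_norm B))//.
  have /ltW := truncnS_gt (`|B| / (c - 1)).
  by rewrite ler_pdivrMr// mulrC => /le_trans; apply; rewrite lerDr.
exists n; apply: (le_trans hn); elim: n {hn} => [|n IHn].
  by rewrite mulr0n addr0 expr0.
have cc : 1 <= c ^+ n by rewrite exprn_ege1// ltW.
rewrite mulrSr addrA exprS (le_trans (lerD IHn (lexx _)))//.
rewrite -lerBrDl -[X in _ <= _ - X]mul1r -mulrBl ler_peMr// subr_ge0 ltW//.
Qed.

(** * Analytic maps are locally Lipschitz *)

Section Lipschitz.
Variables (RR : realType) (c : RR) (R : idomainType) (m : set R).
Hypotheses (hc : 1 < c) (idm : is_ideal m)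
  (sepm : forall x, (forall n, ideal_pow m n x) -> x = 0) (hgr : graded_domain m).
Local Notation P := (ideal_pow m).
Local Notation K := {fraction R}.
Local Notation absR := (ring_abs c m).
Local Notation absK := (frac_abs c m).

Let c_gt0 : 0 < c. Proof. exact: lt_trans hc. Qed.

Definition monomialR r (a : mindex r) (x : 'rV[R]_r) : R :=
  \prod_(i < r) x 0 i ^+ a i.

Lemma monomial_to_frac r (a : mindex r) (x : 'rV[R]_r) :
  monomial a (to_frac x) = tofrac (monomialR a x).
Proof.
rewrite /monomial /monomialR rmorph_prod; apply: eq_bigr => i _.
by rewrite mxE rmorphXn.
Qed.

(** By the product rule, the difference stays [n] levels deeper than the monomials themselves, in
    every degree. The gain of [k] levels per degree will offset coefficients that grow
    geometrically. [D] carries the sizes and the difference through the product together. *)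
Lemma monomialR_congr r (a : mindex r) (x y : 'rV[R]_r) k n :
  polydisc m k x -> polydisc m k y -> polydisc m (n + k) (x - y) ->
  P (n + k * \sum_i a i) (monomialR a x - monomialR a y).
Proof.
move=> xk yk xy.
pose D u v j := [/\ P (k * j) u, P (k * j) v & P (n + k * j) (u - v)].
have D1 : D 1 1 0%N.
  by split; rewrite ?muln0// subrr; exact: ideal_pow0.
have DM u v j u' v' j' : D u v j -> D u' v' j' -> D (u * u') (v * v') (j + j')%N.
  move=> [h1 h2 h3] [h4 h5 h6]; split; rewrite mulnDr; try exact: ideal_powM.
  have -> : u * u' - v * v' = (u - v) * u' + v * (u' - v').
    by rewrite mulrBl mulrBr addrA subrK.
  apply: ideal_powD => //; first by rewrite addnA; apply: ideal_powM.
  by rewrite addnCA; apply: ideal_powM.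
suff [] : D (monomialR a x) (monomialR a y) (\sum_i a i)%N by [].
rewrite /monomialR; elim/big_ind3 : _ => //.
  by move=> u v j u' v' j' h h'; apply: DM.
move=> i _; elim: (a i) => // e IHe; rewrite !exprS.
apply: (DM _ _ 1%N _ _ e) => //; split; rewrite ?muln1//.
by move: (xy i); rewrite !mxE.
Qed.

(** The absolute value is ultrametric, so a bound on each term bounds a partial sum, here over the
    union of two index sets that approximate the two limits within [B]. *)
Lemma pseries_sum_dist r (F : Defs.pseries K r) x y l l' (B : RR) : 0 < B ->
  pseries_sum c m F x l -> pseries_sum c m F y l' ->
  (forall a, absK (F a * (monomial a x - monomial a y)) <= B) ->
  absK (l - l') <= B.
Proof.
move=> B0 /(_ _ B0)[J hJ] /(_ _ B0)[J' hJ'] h.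
have /ltW h1 := hJ _ (fsubsetUl J J'); have /ltW h2 := hJ' _ (fsubsetUr J J').
set S := \sum_(a <- _) _ in h1; set S' := \sum_(a <- _) _ in h2.
have -> : l - l' = (S - S') + (- (S - l) + (S' - l')).
  by ring.
apply: frac_abs_le_add => //; last first.
  by apply: frac_abs_le_add => //; rewrite frac_absN.
rewrite /S /S' -sumrB; apply: frac_abs_le_sum => //; first exact: ltW.
by move=> a; rewrite -mulrBr.
Qed.

(** A term outside [J] is the difference of two partial sums within 1 of the limit, hence at most 1;
    finitely many terms remain. *)
Lemma pseries_sum_bounded r (F : Defs.pseries K r) x l : pseries_sum c m F x l ->
  exists C : RR, forall a, absK (F a * monomial a x) <= C.
Proof.
move=> /(_ _ ltr01)[J hJ].
exists (1 + \sum_(a <- J) absK (F a * monomial a x)) => a.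
have sum_ge0 (s : seq (mindex r)) : 0 <= \sum_(b <- s) absK (F b * monomial b x).
  by apply: sumr_ge0 => b _; exact: frac_abs_ge0.
have [aJ|aJ] := boolP (a \in J).
  by rewrite (big_fsetD1 a)//= addrCA lerDl addr_ge0.
apply: (@le_trans _ _ 1); last by rewrite lerDl.
have /ltW h1 := hJ _ (fsubset_refl J).
have /ltW h2 := hJ _ (fsubsetU1 a J).
move: h2; rewrite big_fsetU1//= => h2.
set S := \sum_(a <- _) _ in h1 h2.
have -> : F a * monomial a x = (F a * monomial a x + S - l) + - (S - l).
  by ring.
by apply: frac_abs_le_add => //; rewrite frac_absN.
Qed.

(** Cauchy's estimate: the terms are bounded at one point with nonzero coordinates, which bounds the
    coefficient of index a by a constant times c^(v |a|). On the polydisc of level v the differences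
    of monomials are small enough to compensate. *)
Lemma analytic_lipschitz r s (V : set 'rV[R]_r) (f : 'rV[R]_r -> 'rV[R]_s)
    (p : R) : p != 0 -> m p ->
  analytic_on c m V f -> V 0 ->
  exists k t : nat, polydisc m k `<=` V /\
    forall x y n, polydisc m k x -> polydisc m k y ->
      polydisc m (n + t) (x - y) -> polydisc m n (f x - f y).
Proof.
move=> p0 mp af /af[l [F hF]].
(* At the point with all coordinates [w] the monomial of index a is w^|a|, so its term controls the
   coefficient. The order [v] of [w] may exceed [l], hence the smaller polydisc of level [v]. *)
pose w := p ^+ l; pose v := adic_ord m w.
have w0 : w != 0 by rewrite expf_neq0.
have Plw : P l w by have := ideal_powX idm l ((ideal_pow1 idm p).2 mp); rewrite mul1n.
have lv : (l <= v)%N by apply/adic_ord_ge.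
have wle : absR w = c ^- v by rewrite /ring_abs (negbTE w0).
have polyl h : polydisc m v h -> polydisc m l h.
  by move=> hv i; apply: ideal_pow_le lv (hv i).
have w_poly : polydisc m l (const_mx w : 'rV[R]_r) by move=> i; rewrite mxE.
have [_ hw] := hF _ w_poly.
have /choice[C hC] i := pseries_sum_bounded (hw i).
(* A single power of [c] dominates the constants of all components. In the shift, [e] pays for it
   and [v] is the margin that [monomialR_congr] requires. *)
have [e he] := exprn_unbounded (\sum_i `|C i|) hc.
exists v, (e + v)%N; split => [h /polyl /hF[]|x y n xv yv xy i].
  by rewrite add0r.
have [_ hx] := hF _ (polyl _ _ xv); have [_ hy] := hF _ (polyl _ _ yv).
rewrite add0r in hx; rewrite add0r in hy.
have -> : (f x - f y) 0 i = f x 0 i - f y 0 i by rewrite !mxE.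
apply/(ring_abs_le hc idm sepm).
rewrite -(frac_abs_tofrac hc idm sepm)// tofracB.
apply: pseries_sum_dist (hx i) (hy i) _; first by rewrite invr_gt0 exprn_gt0.
move=> a; rewrite !monomial_to_frac -tofracB frac_absM// frac_abs_tofrac//.
have hd : absR (monomialR a x - monomialR a y) <= c ^- (n + e + v * \sum_j a j).
  by apply/ring_abs_le => //; apply: monomialR_congr; rewrite // -addnA.
have hFa : absK (F i a) * (c ^- v) ^+ (\sum_j a j) <= c ^+ e.
  apply: le_trans he; rewrite (bigD1 i)//=.
  apply: (@le_trans _ _ (C i)).
    have := hC i a; rewrite frac_absM// monomial_to_frac frac_abs_tofrac//.
    have -> : monomialR a (const_mx w) = w ^+ (\sum_j a j).
      by rewrite /monomialR expr_sum; apply: eq_bigr => j _; rewrite mxE.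
    rewrite -frac_abs_tofrac// tofracXn frac_absX// frac_abs_tofrac//.
    by rewrite wle.
  by rewrite (le_trans (ler_norm _))// lerDl sumr_ge0.
apply: (le_trans (ler_wpM2l (frac_abs_ge0 hc idm sepm hgr _) hd)).
have -> : c ^- (n + e + v * \sum_j a j) =
    c ^- n * (c ^- e * (c ^- v) ^+ (\sum_j a j)).
  by rewrite !exprD !invfM exprM exprVn mulrA.
rewrite mulrCA ler_piMr//; first by rewrite invr_ge0 exprn_ge0// ltW.
by rewrite mulrCA mulrC ler_pdivrMr ?exprn_gt0// mul1r.
Qed.

(** Integral coefficients have absolute value at most 1, so no level is lost. This makes the law of
    a standard group respect congruences exactly. *)
Lemma integral_series_congr r (F : Defs.pseries R r) (x y : 'rV[R]_r) (l l' : R) n :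
  pseries_sum c m (fun a => tofrac (F a)) (to_frac x) (tofrac l) ->
  pseries_sum c m (fun a => tofrac (F a)) (to_frac y) (tofrac l') ->
  polydisc m n (x - y) -> P n (l - l').
Proof.
move=> hx hy xy.
apply/(ring_abs_le hc idm sepm).
rewrite -(frac_abs_tofrac hc idm sepm)// tofracB.
apply: pseries_sum_dist hx hy _; first by rewrite invr_gt0 exprn_gt0.
move=> a; rewrite !monomial_to_frac -tofracB -tofracM frac_abs_tofrac//.
apply/ring_abs_le/ideal_powMl => //.
have := @monomialR_congr _ a x y 0 n; rewrite mul0n !addn0; apply => //.
Qed.

End Lipschitz.

(** * The Hilbert function *)

Section Monomials.
Variables (S b : nat).
Local Notation expo := {ffun 'I_S -> 'I_b.+1}.
Implicit Types (u v : expo) (i : 'I_S).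

Definition deg u := (\sum_i u i)%N.
(** The exponents are digits in base b + 1, so the weight is injective; multiplication by a
    generator adds a constant to it. It therefore serves as a monomial order. *)
Definition weight u := (\sum_i u i * b.+1 ^ i)%N.
(** Multiplication by the i-th indeterminate. Below degree [b] the value passed to [inord] stays in
    range; bounding the exponents by [b] makes the monomials a finite type. *)
Definition incr i u : expo := [ffun j => inord (u j + (j == i))].

Lemma incrE i u j : (deg u < b)%N -> incr i u j = (u j + (j == i))%N :> nat.
Proof.
move=> ub; rewrite ffunE inordK// ltnS.
have : (u j <= deg u)%N by rewrite /deg (bigD1 j)//= leq_addr.
by case: (j == i); lia.
Qed.

Lemma deg_incr i u : (deg u < b)%N -> deg (incr i u) = (deg u).+1.
Proof.
move=> ub; rewrite /deg; under eq_bigr do rewrite incrE//.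
rewrite big_split/= (_ : (\sum_j (j == i) = 1)%N) ?addn1//.
by rewrite (bigD1 i)//= eqxx big1// => j /negbTE ->.
Qed.

Lemma weight_incr i u : (deg u < b)%N -> weight (incr i u) = (weight u + b.+1 ^ i)%N.
Proof.
move=> ub; rewrite /weight; under eq_bigr do rewrite incrE// mulnDl.
rewrite big_split/=; congr addn.
by rewrite (bigD1 i)//= eqxx mul1n big1 ?addn0// => j /negbTE ->.
Qed.

Lemma incr_inj i u v : (deg u < b)%N -> (deg v < b)%N -> incr i u = incr i v -> u = v.
Proof.
move=> ub vb uv; apply/ffunP => j; apply: val_inj => /=.
by have := congr1 (fun w : expo => w j : nat) uv; rewrite /= !incrE// => /addIn.
Qed.

Lemma incr_surj i u : (0 < u i)%N -> (deg u <= b)%N ->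
  exists2 v, u = incr i v & deg u = (deg v).+1.
Proof.
move=> ui ub; pose v : expo := [ffun j => inord (u j - (j == i))].
have vE j : v j = (u j - (j == i))%N :> nat.
  by rewrite ffunE inordK// (leq_ltn_trans (leq_subr _ _)).
have dv : deg u = (deg v).+1.
  rewrite /deg (bigD1 i)//= [in RHS](bigD1 i)//= vE eqxx -addSn; congr addn.
    by lia.
  by apply: eq_bigr => j /negbTE ji; rewrite vE ji subn0.
have vb : (deg v < b)%N by rewrite -dv.
exists v => //; apply/ffunP => j; apply: val_inj.
by rewrite [RHS]/= incrE// vE; case: eqP => [->|_] /=; lia.
Qed.

End Monomials.

Lemma digits_inj b n (f g : nat -> nat) :
  (forall i, f i <= b)%N -> (forall i, g i <= b)%N ->
  (\sum_(i < n) f i * b.+1 ^ i = \sum_(i < n) g i * b.+1 ^ i)%N ->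
  forall i, (i < n)%N -> f i = g i.
Proof.
elim: n f g => [//|n IHn] f g fb gb; rewrite !big_ord_recl/= !expn0 !muln1.
have split h : (\sum_(i < n) h (bump 0 i) * b.+1 ^ bump 0 i =
    b.+1 * \sum_(i < n) (h \o S) i * b.+1 ^ i)%N.
  by rewrite big_distrr/=; apply: eq_bigr => i _; rewrite /bump/= expnS mulnCA.
rewrite !split => e.
have e0 : f 0%N = g 0%N.
  have := congr1 (modn^~ b.+1) e.
  rewrite /= ![(b.+1 * _)%N]mulnC ![(_ + _ * b.+1)%N]addnC !modnMDl.
  by rewrite !modn_small ?ltnS.
case=> [//|i]; rewrite ltnS => /(IHn (f \o S) (g \o S)); apply.
- by move=> j; exact: fb.
- by move=> j; exact: gb.
- by move/eqP: e; rewrite e0 eqn_add2l eqn_mul2l/= => /eqP.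
Qed.

Lemma weight_inj S b : injective (@weight S b).
Proof.
move=> u v uv; apply/ffunP => i; apply: val_inj => /=.
pose ext (w : {ffun 'I_S -> 'I_b.+1}) k :=
  if insub k is Some j then w j : nat else 0%N.
have extE w (j : 'I_S) : ext w j = w j by rewrite /ext valK.
have extb w k : (ext w k <= b)%N.
  by rewrite /ext; case: insubP => // j _ _; rewrite -ltnS.
rewrite -(extE u) -(extE v); apply: (digits_inj (extb u) (extb v) (n := S)) => //.
under eq_bigr do rewrite extE; under [RHS]eq_bigr do rewrite extE.
exact: uv.
Qed.

#[local] Arguments ideal_pow : simpl never.

Section StandardMonomials.
Variables (R : idomainType) (m : set R) (s : seq R).
Hypotheses (maxm : maximal_ideal m) (ms : m = ideal_gen s).
Local Notation P := (ideal_pow m).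
Local Notation S := (size s).

Let idm : is_ideal m. Proof. by case: maxm. Qed.

Section Bound.
Variable b : nat.
Local Notation expo := {ffun 'I_S -> 'I_b.+1}.
Implicit Types (u v : expo).

Definition mono u : R := \prod_(i < S) s`_i ^+ u i.

Lemma gen_in (i : 'I_S) : m s`_i.
Proof. by rewrite ms => J _; apply; apply: mem_nth. Qed.

Lemma mono_incr i u : (deg u < b)%N -> mono (incr i u) = s`_i * mono u.
Proof.
move=> ub; rewrite /mono; under eq_bigr do rewrite incrE// exprD.
rewrite big_split/= mulrC; congr (_ * _).
by rewrite (bigD1 i)//= eqxx expr1 big1 ?mulr1// => j /negbTE ->; rewrite expr0.
Qed.

Lemma mono_in u : P (deg u) (mono u).
Proof.
rewrite /mono /deg; elim/big_ind2 : _ => //.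
  by move=> x i y j xi yj; exact: ideal_powM.
move=> i _; rewrite -[X in P X _]mul1n; apply: ideal_powX => //.
by apply/ideal_pow1 => //; exact: gen_in.
Qed.

(** Two colon ideals of [J] carry the induction: by the second factor of a product, to replace the
    first factor by a generator, then by that generator, to descend to degree [n]. *)
Lemma ideal_pow_sub_mono n (J : set R) : (n <= b)%N -> is_ideal J ->
  (forall u, deg u = n -> J (mono u)) -> P n `<=` J.
Proof.
elim: n J => [|n IHn] J nb idJ hJ.
  move=> x _; case: (idJ) => _ _ JM; rewrite -[x]mulr1; apply: JM.
  have -> : 1 = mono [ffun=> ord0].
    by rewrite /mono big1// => i _; rewrite ffunE expr0.
  by apply: hJ; rewrite /deg big1// => i _; rewrite ffunE.
have [J0 JD JM] := idJ.
move=> _ [r rP ->]; rewrite big_seq; elim/big_ind: _ => // z /rP[+ z2].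
rewrite ms => /(_ [set a | J (a * z.2)]); apply.
  split => /=; first by rewrite mul0r.
    by move=> x y hx hy; rewrite mulrDl; exact: JD.
  by move=> a x hx; rewrite -mulrA; exact: JM.
move=> y /(nthP 0)[k kS <-]; pose i := Ordinal kS.
have := IHn [set a | J (s`_i * a)] (ltnW nb); apply => //.
  split => /=; first by rewrite mulr0.
    by move=> x y' hx hy; rewrite mulrDr; exact: JD.
  by move=> a x hx; rewrite mulrCA; exact: JM.
move=> u un /=; have ub : (deg u < b)%N by rewrite un.
by rewrite -[_ * _](mono_incr i ub); apply: hJ; rewrite deg_incr// un.
Qed.

(* Generated ideals are expressed as intersections, so that an inclusion is
   proved by exhibiting a single ideal. *)
Definition lowspan n w : set R :=
  [set z | forall J, is_ideal J -> P n.+1 `<=` J ->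
    (forall v, deg v = n -> (weight v < w)%N -> J (mono v)) -> J z].

(** As for Groebner bases: the monomials of degree [n] that are not combinations of lower ones
    modulo m^(n+1). Their classes turn out to be a basis of m^n / m^(n+1) over R / m. *)
Definition standard n : {set expo} :=
  [set u | (deg u == n) && ~~ `[< lowspan n (weight u) (mono u) >]]%SET.

Lemma standardP n u : u \in standard n ->
  deg u = n /\ ~ lowspan n (weight u) (mono u).
Proof. by rewrite inE => /andP[/eqP -> /asboolPn]. Qed.

Lemma lowspan_ideal n w : is_ideal (lowspan n w).
Proof.
split.
- by move=> J [].
- by move=> x y hx hy J idJ PJ h; case: (idJ) => _ + _; apply; [exact: hx|exact: hy].
- by move=> a x hx J idJ PJ h; case: (idJ) => _ _; apply; exact: hx.
Qed.

Lemma lowspan_mono n u v : deg v = n -> (weight v < weight u)%N ->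
  lowspan n (weight u) (mono v).
Proof. by move=> vn vu J _ _; apply. Qed.

(** Multiplication by a generator maps m^(n+1) into m^(n+2) and raises all weights by the same
    amount. Contrapositively, a divisor of a standard monomial is standard. *)
Lemma lowspan_incr n i u : (n < b)%N -> deg u = n -> lowspan n (weight u) (mono u) ->
  lowspan n.+1 (weight (incr i u)) (mono (incr i u)).
Proof.
move=> nb un h J idJ PJ hJ; have ub : (deg u < b)%N by rewrite un.
have [J0 JD JM] := idJ.
rewrite mono_incr//; apply: (h [set a | J (s`_i * a)]) => /=.
- split => /=; first by rewrite mulr0.
    by move=> x y hx hy; rewrite mulrDr; exact: JD.
  by move=> a x hx; rewrite mulrCA; exact: JM.
- move=> x Px; apply: PJ; rewrite -add1n; apply: ideal_powM => //.
  by apply/ideal_pow1 => //; exact: gen_in.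
- move=> v vn vu; have vb : (deg v < b)%N by rewrite vn.
  by rewrite -mono_incr//; apply: hJ; rewrite ?deg_incr ?vn// !weight_incr// ltn_add2r.
Qed.

(* Divisors of standard monomials are standard; count pairs of a standard
   monomial of degree n + 1 and a divisor of degree n, with the multiplicity of
   the quotient. *)
Lemma card_standard n : (n < b)%N ->
  (n.+1 * #|standard n.+1| <= (n + S) * #|standard n|)%N.
Proof.
move=> nb.
have -> : (n.+1 * #|standard n.+1| = \sum_(u in standard n.+1) deg u)%N.
  rewrite mulnC -sum_nat_const; apply: eq_bigr => u /standardP[un _].
  by rewrite un.
(* [u i + 1] is the exponent of the i-th generator in the multiple [incr i u], so the two sums can
   be compared for each [i] separately. *)
have -> : ((n + S) * #|standard n| = \sum_(u in standard n) \sum_i (u i + 1))%N.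
  rewrite mulnC -sum_nat_const; apply: eq_bigr => u /standardP[un _].
  by rewrite big_split/= -/(deg u) un sum_nat_const card_ord muln1.
rewrite /deg exchange_big [leqRHS]exchange_big/=; apply: leq_sum => i _.
have lt_b v : v \in standard n -> (deg v < b)%N by case/standardP => ->.
have -> : (\sum_(v in standard n) (v i + 1) =
           \sum_(u in incr i @: standard n) u i)%N.
  rewrite big_imset/=.
    by apply: eq_bigr => v /lt_b vb; rewrite incrE// eqxx.
  by move=> u v /lt_b ub /lt_b vb; exact: incr_inj.
rewrite (bigID (fun u : expo => 0 < u i)%N)/= [X in (_ + X)%N]big1 ?addn0; last first.
  by move=> u /andP[_]; rewrite -eqn0Ngt => /eqP.
rewrite [leqRHS](bigID (fun u : expo => (u \in standard n.+1) && (0 < u i)%N))/=.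
rewrite (leq_trans _ (leq_addr _ _))//.
rewrite [leqLHS](eq_bigl (fun u =>
  (u \in incr i @: standard n) && ((u \in standard n.+1) && (0 < u i)%N)))// => u.
case: (boolP (_ && (0 < _)%N)) => [/andP[us ui]|]; last by rewrite andbF.
have [un nlow] := standardP us.
have [|v uv uv'] := incr_surj ui; first by rewrite un.
have vn : deg v = n by apply: succn_inj; rewrite -uv' un.
rewrite andbT; symmetry; apply/imsetP; exists v => //.
rewrite inE vn eqxx/=; apply/asboolPn => low; apply: nlow.
by rewrite uv; apply: lowspan_incr.
Qed.

Section Count.
Variables (q : nat) (t : 'I_q -> R).
Hypothesis tP : representatives (fun x y => m (x - y)) setT t.

(** Induction on the weight: a monomial that is not standard lies in the ideal generated by m^(n+1)
    and lower monomials, which are already expressed. *)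
Lemma standard_span n x : (n <= b)%N -> P n x ->
  exists a : 'I_#|standard n| -> R,
    P n.+1 (x - \sum_j a j * mono (enum_val j)).
Proof.
move=> nb; pose J : set R := [set x | exists a : 'I_#|standard n| -> R,
    P n.+1 (x - \sum_j a j * mono (enum_val j))].
have idJ : is_ideal J.
  split.
  - exists (fun=> 0); rewrite big1 ?subr0; first exact: ideal_pow0.
    by move=> j _; rewrite mul0r.
  - move=> y z [f hf] [g hg]; exists (fun j => f j + g j).
    under eq_bigr do rewrite mulrDl.
    rewrite big_split/= opprD addrACA. exact: ideal_powD.
  - move=> c y [f hf]; exists (fun j => c * f j).
    under eq_bigr do rewrite -mulrA.
    by rewrite -mulr_sumr -mulrBr; exact: ideal_powMl.
have PJ : P n.+1 `<=` J.
  move=> y Py; exists (fun=> 0); rewrite big1 ?subr0// => j _.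
  by rewrite mul0r.
apply: (@ideal_pow_sub_mono n J) => // u.
have [w] := ubnP (weight u); elim: w u => [//|w IHw] u uw un.
have [us|us] := boolP (u \in standard n).
  pose j0 := enum_rank_in us u; exists (fun j => (j == j0)%:R).
  rewrite (bigD1 j0)//= eqxx mul1r enum_rankK_in// big1 ?addr0 ?subrr.
    exact: ideal_pow0.
  by move=> j /negbTE ->; rewrite mul0r.
move: us; rewrite inE un eqxx/= negbK => /asboolP; apply => // v vn vu.
by apply: IHw => //; exact: leq_trans vu _.
Qed.

(** Every class has a unique expression in the standard monomials with coefficients among the [q]
    chosen residues. *)
Lemma nclasses_layer n : (n <= b)%N ->
  nclasses (fun x y => P n.+1 (x - y)) (P n) (q ^ #|standard n|).
Proof.
move=> nb; have [_ tI tS] := tP; have [m0 mD mM] := idm.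
rewrite -[q]card_ord -[#|standard n|]card_ord -card_ffun.
apply: (@nclasses_representatives _ _ _ _
  (fun f : {ffun 'I_#|standard n| -> 'I_q} => \sum_j t (f j) * mono (enum_val j))).
split.
- move=> f; apply: ideal_pow_sum => // j _; apply: ideal_powMl => //.
  have /standardP[jn _] := enum_valP j; rewrite -[X in P X]jn; exact: mono_in.
- move=> f g fg; apply/eqP; apply: contraPT fg => /eqP fg.
  have [j0 j0P] : exists j, f j != g j.
    apply: contrapT => h; apply: fg; apply/ffunP => j; apply: contrapT => /eqP hj.
    by apply: h; exists j.
  (* Where two expressions differ, take the monomial of largest weight: its coefficient is
     invertible modulo [m], so this monomial would be a combination of lower ones, contrary to being
     standard. *)
  case: (@arg_maxnP _ j0 (fun j => f j != g j) (fun j => weight (enum_val j))) => //.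
  move=> j fgj jmax; rewrite -sumrB; under eq_bigr do rewrite -mulrBl.
  pose d i := t (f i) - t (g i); rewrite -/(d _) => Pd.
  have nmd : ~ m (d j) by move/tI/eqP; rewrite (negbTE fgj).
  (* Maximality of [m], applied to the ideal generated by [m] and [d j], inverts [d j] modulo
     [m]. *)
  have [e me] : exists e, m (1 - e * d j).
    case: maxm => _ mT /(_ [set z | exists a, m (z - a * d j)]) [].
    - split.
      + by exists 0; rewrite mul0r subr0.
      + move=> x y [a xa] [a' ya]; exists (a + a').
        by rewrite mulrDl opprD addrACA; exact: mD.
      + by move=> a x [a' xa]; exists (a * a'); rewrite -mulrA -mulrBr; exact: mM.
    - by move=> x mx; exists 0; rewrite mul0r subr0.
    - move=> h; exfalso; apply: nmd; rewrite -h; exists 1.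
      by rewrite mul1r subrr.
    - by move=> h; have : setT (1 : R) by []; rewrite -h => -[e he]; exists e.
  have /standardP[jn] := enum_valP j; apply.
  have [L0 LD LM] := lowspan_ideal n (weight (enum_val j)).
  have PL : P n.+1 `<=` lowspan n (weight (enum_val j)) by move=> z Pz J _ PJ _; exact: PJ.
  rewrite -[mono _]mul1r -[1](subrK (e * d j)) mulrDl; apply: (LD).
    apply: PL; rewrite -add1n; apply: ideal_powM => //; first exact/ideal_pow1.
    by rewrite -[X in P X]jn; exact: mono_in.
  rewrite -mulrA; apply: (LM).
  move: Pd; rewrite (bigD1 j)//= => /PL Pd.
  rewrite -[d j * _](addrK (\sum_(i | i != j) d i * mono (enum_val i))).
  apply: (LD) => //; rewrite -mulN1r; apply: (LM).
  elim/big_ind: _ => // i ij; rewrite /d.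
  have [<-|fgi] := eqVneq (f i) (g i); first by rewrite subrr mul0r.
  apply: (LM); apply: lowspan_mono; first by case: (standardP (enum_valP i)).
  rewrite ltn_neqAle; apply/andP; split; last exact: jmax.
  apply: contra ij => /eqP /weight_inj.
  by move/enum_val_inj => ->.
- move=> x /(standard_span nb)[a Pxa].
  have /choice[g gP] j := tS (a j) I.
  exists [ffun j => g j]; apply: ideal_powB_trans Pxa _ => //.
  rewrite -sumrB; apply: ideal_pow_sum => // j _; rewrite -mulrBl ffunE.
  rewrite -add1n; apply: ideal_powM => //; first exact/ideal_pow1.
  have /standardP[jn _] := enum_valP j; rewrite -[X in P X]jn; exact: mono_in.
Qed.

End Count.
End Bound.
End StandardMonomials.

Section HilbertFunction.
Variables (R : idomainType) (m : set R).
Hypotheses (noeth : noetherian R) (maxm : maximal_ideal m)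
  (finm : finite_set (residues m)).
Local Notation P := (ideal_pow m).

Let idm : is_ideal m. Proof. by case: maxm. Qed.

Lemma residues_representatives :
  exists2 q, (1 < q)%N & exists t : 'I_q -> R,
    representatives (fun x y => m (x - y)) setT t.
Proof.
have [m0 mD mM] := idm.
have sym x y : m (x - y) -> m (y - x).
  by move=> /(mM (-1)); rewrite mulN1r opprB.
have trans x y z : m (x - y) -> m (y - z) -> m (x - z).
  by move=> xy /(mD _ _ xy); rewrite addrA subrK.
have /finite_fsetP[X XE] := finm.
have /choice[t tP] (z : X) : exists x, [set y | m (y - x)] = val z.
  have : residues m (val z) by rewrite XE /=; exact: valP.
  by case=> x _ <-; exists x.
have [s sP] : nclasses (fun x y => m (x - y)) setT #|{: X}|.
  apply: (nclasses_representatives (t := t)); split => // [i j tij|x _].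
    apply: val_inj; rewrite -!tP; apply/seteqP; split => y /= h.
      exact: trans h tij.
    by apply: trans h _; exact: sym.
  have : residues m [set y | m (y - x)] by exists x.
  rewrite XE /= => xX; exists [` xX]%fset.
  have /= := tP [` xX]%fset; move/seteqP => [_ /(_ x)]; apply.
  by rewrite /= subrr.
have m1 : ~ m 1.
  move=> m1; case: maxm => _ + _; apply; apply/seteqP; split => // x _.
  by rewrite -[x]mulr1; exact: mM.
exists #|{: X}|; last by exists s.
have [_ sI sS] := sP; move: s sI sS {sP}.
case: #|{: X}| => [|[|//]] s sI sS; first by have [[]] := sS 0 I.
have [i h1] := sS 1 I; have [j h0] := sS 0 I.
exfalso; apply: m1; rewrite -[1]subr0; apply: trans h1 _; apply: sym.
by rewrite (ord1 i) -(ord1 j).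
Qed.

Lemma hilbert_function : exists (q S : nat) (mu : nat -> nat),
  [/\ (1 < q)%N,
      forall n, nclasses (fun x y => P n.+1 (x - y)) (P n) (q ^ mu n) &
      forall n, (n.+1 * mu n.+1 <= (n + S) * mu n)%N].
Proof.
have [q q1 [t tP]] := residues_representatives.
have [s ms] := noeth idm.
pose mu n := #|standard m s n.+1 n|.
(* The type of monomials depends on the bound [b], but the number of standard ones is fixed by the
   number of classes of the layer. Degrees n and n + 1 can thus be compared under one bound. *)
have muP b n : (n <= b)%N -> #|standard m s b n| = mu n.
  move=> nb; apply/eqP; rewrite -(eqn_exp2l _ _ q1); apply/eqP.
  apply: (nclasses_uniq (E := fun x y => P n.+1 (x - y)) (X := P n)).
  - by move=> x y; exact: ideal_powBC.
  - by move=> x y z; exact: ideal_powB_trans.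
  - exact: (nclasses_layer maxm ms tP nb).
  - exact: (nclasses_layer maxm ms tP (leqnSn n)).
exists q, (size s), mu; split => // n; first exact: (nclasses_layer maxm ms tP (leqnSn n)).
have := card_standard maxm ms (ltnSn n).
by rewrite !muP.
Qed.

End HilbertFunction.

Section Counting.
Variables (R : idomainType) (m : set R) (q : nat) (mu : nat -> nat).
Hypotheses (idm : is_ideal m) (q1 : (1 < q)%N).
Local Notation P := (ideal_pow m).
Hypothesis muP : forall n, nclasses (fun x y => P n.+1 (x - y)) (P n) (q ^ mu n).

Lemma nclasses_translate n k x a : nclasses (fun x y => P k (x - y)) (P n) a ->
  nclasses (fun x y => P k (x - y)) [set y | P n (y - x)] a.
Proof.
case=> t [tX tI tS]; exists (fun i => t i + x); split.
- by move=> i; rewrite /= addrK.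
- by move=> i j; rewrite opprD addrACA subrr addr0 => /tI.
- by move=> y /tS[i yi]; exists i; rewrite opprD addrCA addrC.
Qed.

Lemma nclasses_ideal_pow k n :
  nclasses (fun x y => P (k + n) (x - y)) (P k) (q ^ \sum_(k <= i < k + n) mu i).
Proof.
elim: n => [|n IHn].
  rewrite addn0 big_geq//; exists (fun=> 0); split.
  - by move=> _; exact: ideal_pow0.
  - by move=> i j _; rewrite !ord1.
  - by move=> x Px; exists ord0; rewrite subr0.
rewrite addnS big_nat_recr ?leq_addr//= expnD.
apply: (nclasses_mul (E' := fun x y => P (k + n) (x - y))) IHn _.
- by move=> x y; exact: ideal_powBC.
- by move=> x y z; exact: ideal_powB_trans.
- by move=> x y; exact: ideal_powS.
move=> x Px; have := nclasses_translate x (muP (k + n)).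
congr nclasses; apply/seteqP; split => [y /= Py|y []//].
split => //=; rewrite -[y](subrK x); apply: ideal_powD => //.
by apply: ideal_pow_le Py; rewrite ?leq_addr.
Qed.

(** A trivial layer would force m^n = m^(n+1) = ..., hence m^n = 0 by separation, while [x ^+ n] is
    nonzero in a domain. *)
Lemma mu_gt0 n : (forall x, (forall n, P n x) -> x = 0) ->
  (exists2 x, x != 0 & m x) -> (0 < mu n)%N.
Proof.
move=> sep [x x0 mx]; rewrite lt0n; apply/eqP => mun.
have PS y : P n y -> P n.+1 y.
  move=> Py; have [t [tX tI tS]] := muP n; rewrite mun expn0 in t tX tI tS.
  have [i yi] := tS _ Py; have [j oj] := tS _ (ideal_pow0 idm n).
  rewrite -[y]subr0; apply: ideal_powB_trans yi _ => //.
  by apply: ideal_powBC => //; rewrite (ord1 i) -(ord1 j).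
have PSk k y : P (k + n) y -> P (k + n).+1 y.
  elim: k y => [|k IHk] y; first exact: PS.
  rewrite addSn => -[s sP ->]; exists s => // u /sP[u1 u2]; split => //.
  exact: IHk.
have PA k : P n `<=` P (k + n).
  by elim: k => [//|k IHk] y /IHk /PSk.
have : x ^+ n = 0.
  apply: sep => k; apply: (@ideal_pow_le _ _ idm _ (k + n)); first exact: leq_addr.
  by apply: PA; have := ideal_powX idm n ((ideal_pow1 idm x).2 mx); rewrite mul1n.
by move/eqP; rewrite expf_eq0 (negbTE x0) andbF.
Qed.

End Counting.

(** * Slow growth of the length function *)

Section Growth.
Variables (S : nat) (mu : nat -> nat).
Hypothesis muS : forall n, (n.+1 * mu n.+1 <= (n + S) * mu n)%N.

Lemma mu_ratio j : exists f, forall n, (S <= n)%N ->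
  (n * mu (n + j) <= (n + f) * mu n)%N.
Proof.
elim: j => [|j [f hf]]; first by exists 0%N => n _; rewrite !addn0.
(* For S <= n one has (n + S)(n + f) <= n (n + S + 2 f), which turns two successive factors into one
   of the same form. *)
exists (S + 2 * f)%N => n Sn; have h := hf _ Sn.
have h1 : (n * mu (n + j.+1) <= (n + S) * mu (n + j))%N.
  by rewrite addnS; have := muS (n + j); nia.
have [->//|n0] := posnP n.
rewrite -(leq_pmul2l n0); apply: (@leq_trans ((n + S) * (n * mu (n + j)))).
  by rewrite mulnCA leq_mul2l h1 orbT.
apply: (@leq_trans ((n + S) * ((n + f) * mu n))).
  by rewrite leq_mul2l h orbT.
rewrite !mulnA leq_mul2r; apply/orP; right.
have : (S * f <= n * f)%N by rewrite leq_mul2r Sn orbT.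
nia.
Qed.

Lemma mu_double L : exists n0, forall n j, (n0 <= n)%N -> (j <= L)%N ->
  (mu (n + j) <= 2 * mu n)%N.
Proof.
have one j : exists n0, forall n, (n0 <= n)%N -> (mu (n + j) <= 2 * mu n)%N.
  have [f hf] := mu_ratio j; exists (S + f).+1 => n nf.
  have := hf n; rewrite (leq_trans _ nf); last by lia.
  move=> /(_ isT) h; rewrite -(@leq_pmul2l n); last by lia.
  by apply: (leq_trans h); rewrite mulnA leq_mul2r; apply/orP; right; lia.
elim: L => [|L [n0 hn0]].
  by exists 0%N => n j _; rewrite leqn0 => /eqP ->; rewrite addn0; lia.
have [n1 hn1] := one L.+1; exists (maxn n0 n1) => n j.
rewrite geq_max => /andP[nn0 nn1]; rewrite leq_eqVlt => /orP[/eqP ->|].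
  exact: hn1.
by rewrite ltnS; exact: hn0.
Qed.

Lemma sum_mu_slow t K : exists n0, forall n, (n0 <= n)%N ->
  (K * \sum_(n <= i < n + t) mu i <= \sum_(0 <= i < n) mu i)%N.
Proof.
(* Each of the [t] layers from [n] on has [mu] at most 2 mu_n, and each of the [L] layers before [n]
   at least mu_n / 2. Hence L / 2 = 2 K t is what [K] times the tail requires. *)
pose L := (4 * K * t)%N; have [n0 h] := mu_double (L + t).
exists (n0 + L)%N => n nn.
have h1 : (\sum_(n <= i < n + t) mu i <= t * (2 * mu n))%N.
  rewrite -{1}[n]add0n big_addn addKn.
  rewrite -[X in (_ <= X * _)%N]subn0 -sum_nat_const_nat !big_nat.
  apply: leq_sum => i /andP[_ it]; rewrite addnC; apply: h; lia.
have h2 : (L * mu n <= 2 * \sum_(0 <= i < n) mu i)%N.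
  rewrite (@big_cat_nat _ _ _ (n - L)%N) ?leq_subr//= mulnDr.
  apply: leq_trans (leq_addl _ _); rewrite big_distrr/=.
  have {1}-> : L = (n - (n - L))%N by lia.
  rewrite -sum_nat_const_nat !big_nat; apply: leq_sum => i /andP[i1 i2].
  by have := h i (n - i)%N; rewrite subnKC ?(ltnW i2)//; apply; lia.
rewrite -(@leq_pmul2l 2)//; apply: leq_trans h2.
apply: (@leq_trans (2 * (K * (t * (2 * mu n))))); last by rewrite /L; lia.
by rewrite leq_mul2l/= leq_mul2l h1 orbT.
Qed.

End Growth.

(** * Integral points of a subspace *)

Section Subspaces.
Variable R : idomainType.
Local Notation K := {fraction R}.

Lemma common_denominator (I : finType) (f : I -> K) :
  exists2 b : R, b != 0 & exists a : I -> R, forall i, tofrac b * f i = tofrac (a i).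
Proof.
have /choice[g gP] i : exists z : R * R, z.2 != 0 /\ f i = tofrac z.1 / tofrac z.2.
  by have [a [b [b0 fE]]] := fraction_repr (f i); exists (a, b).
exists (\prod_i (g i).2); first by apply/prodf_neq0 => i _; case: (gP i).
exists (fun i => (g i).1 * \prod_(j | j != i) (g j).2) => i.
have [gi0 ->] := gP i; rewrite (bigD1 i)//= !tofracM.
by rewrite mulrC mulrA divfK ?tofrac_eq0.
Qed.

Lemma to_frac_inj d : injective (@to_frac R d).
Proof.
move=> x y xy; apply/rowP => i; apply/eqP; rewrite -tofrac_eq; apply/eqP.
by move/rowP: xy => /(_ i); rewrite !mxE.
Qed.

(** With R^e M the row lattice of [M], this says that b (E /\ R^d) lies in R^e M, which lies in E /\
    R^d, and that the coordinates selected by [pi] recover the parameter up to the factor [b]. *)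
Lemma subspace_parametrization d (E : {vspace 'rV[K]_d}) :
  exists (pi : 'I_(\dim E) -> 'I_d) (b : R) (M : 'M[R]_(\dim E, d)),
    [/\ b != 0,
        forall y, to_frac y \in E -> b *: y = mxsub id pi y *m M,
        forall w, to_frac (w *m M) \in E &
        forall w : 'rV_(\dim E), mxsub id pi (w *m M) = b *: w].
Proof.
set e := \dim E; pose B : 'M[K]_(e, d) := \matrix_(i < e) (vbasis E)`_i.
have BE (a : 'rV_e) : a *m B \in E.
  rewrite mulmx_sum_row; apply: memv_suml => i _; rewrite rowK.
  by apply: memvZ; apply: vbasis_mem; apply: mem_nth; rewrite size_tuple.
have EB y : y \in E -> exists a : 'rV_e, y = a *m B.
  move=> /coord_vbasis yE; exists (\row_i coord (vbasis E) i y).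
  rewrite mulmx_sum_row [LHS]yE; apply: eq_bigr => i _.
  by rewrite rowK mxE.
have freeB : row_free B.
  apply: inj_row_free => v; rewrite mulmx_sum_row => v0.
  have /freeP/(_ (fun i => v 0 i)) h := basis_free (vbasisP E).
  apply/rowP => i; rewrite [RHS]mxE; apply: h.
  by rewrite -[RHS]v0; apply: eq_bigr => j _; rewrite rowK.
have fullB : row_full B^T by rewrite /row_full mxrank_tr.
(* [pi] selects columns forming an invertible minor [C] of a basis matrix; normalizing by [C] puts
   the identity there, and clearing denominators turns it into [b] times the identity. *)
pose pi := fullrankfun fullB; pose C := mxsub id pi B.
have uC : C \in unitmx.
  rewrite -unitmx_tr /C trmx_mxsub; exact: fullrowsub_unit.
pose N := invmx C *m B.
have Npi : mxsub id pi N = 1%:M by rewrite /N -mulmx_colsub mulVmx.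
have [b b0 [a ab]] := common_denominator (fun z : 'I_e * 'I_d => N z.1 z.2).
pose M : 'M[R]_(e, d) := \matrix_(i, j) a (i, j).
have ME : map_mx (@tofrac R) M = tofrac b *: N.
  by apply/matrixP => i j; rewrite [LHS]mxE [RHS]mxE [M _ _]mxE -ab.
exists pi, b, M; split => //.
- move=> y /EB[v yv]; apply: to_frac_inj.
  rewrite /to_frac map_mxZ map_mxM map_mxsub ME -/(to_frac y) yv -mulmx_colsub -/C.
  by rewrite -scalemxAr /N mulmxA mulmxK.
- by move=> w; rewrite /to_frac map_mxM ME -scalemxAr scalemxAl mulmxA; exact: BE.
- move=> w; apply: to_frac_inj.
  rewrite /to_frac map_mxsub map_mxM ME map_mxZ -scalemxAr linearZ/=.
  by rewrite -mulmx_colsub Npi mulmx1.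
Qed.
End Subspaces.

Lemma compact_finite_subcover (T : topologicalType) (x0 : T) (I : choiceType)
    (f : I -> set T) : compact [set: T] ->
  (forall i, open (f i)) -> (forall x, exists i, f i x) ->
  exists D : {fset I}, forall x, exists2 i, i \in D & f i x.
Proof.
move=> cT fo fc.
pose T' : ptopologicalType := HB.pack_for ptopologicalType T (isPointed.Build T x0).
have : @cover_compact T' setT by rewrite -compact_cover.
move=> /(_ I setT f) [].
- by move=> i _; exact: fo.
- by move=> x _; have [i fi] := fc x; exists i.
move=> D _ cD; exists D => x; have [|i iD fi] := cD x; first by [].
by exists i.
Qed.

(** * Standard groups *)

Section Polydiscs.
Variables (R : idomainType) (m : set R) (d : nat).
Hypothesis idm : is_ideal m.
Implicit Types x y z : 'rV[R]_d.

Lemma polydisc0 n : polydisc m n (0 : 'rV[R]_d).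
Proof. by move=> i; rewrite mxE; exact: ideal_pow0. Qed.

Lemma polydiscD n x y : polydisc m n x -> polydisc m n y -> polydisc m n (x + y).
Proof. by move=> hx hy i; rewrite mxE; apply: ideal_powD. Qed.

Lemma polydiscN n x : polydisc m n x -> polydisc m n (- x).
Proof. by move=> hx i; rewrite mxE; apply: ideal_powN. Qed.

Lemma polydiscB n x y : polydisc m n x -> polydisc m n y -> polydisc m n (x - y).
Proof. by move=> hx hy; apply/polydiscD/polydiscN. Qed.

Lemma polydiscBC n x y : polydisc m n (x - y) -> polydisc m n (y - x).
Proof. by move=> /polydiscN; rewrite opprB. Qed.

Lemma polydiscB_trans n x y z :
  polydisc m n (x - y) -> polydisc m n (y - z) -> polydisc m n (x - z).
Proof. by move=> xy /(polydiscD xy); rewrite addrA subrK. Qed.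

Lemma polydisc_le k n x : (k <= n)%N -> polydisc m n x -> polydisc m k x.
Proof. by move=> kn hx i; apply: ideal_pow_le kn (hx i). Qed.

Lemma polydisc_sub_row a b (x x' : 'rV[R]_a) (z : 'rV[R]_b) n :
  polydisc m n (x - x') -> polydisc m n (row_mx x z - row_mx x' z).
Proof.
move=> xx' i; rewrite opp_row_mx add_row_mx subrr mxE.
case: (fintype.split i) => j; first exact: xx'.
by rewrite mxE; exact: ideal_pow0.
Qed.

Lemma nclasses_polydisc k n c :
  nclasses (fun a b => ideal_pow m n (a - b)) (ideal_pow m k) c ->
  nclasses (fun x y => polydisc m n (x - y)) (polydisc m k) (c ^ d).
Proof.
move=> /(nclasses_row d); congr nclasses.
apply/funext => x; apply/funext => y; rewrite propeqE.
by split => h i; have := h i; rewrite !mxE.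
Qed.

Lemma polydisc_adic_open n : adic_open m (polydisc m n : set 'rV[R]_d).
Proof. by move=> x hx; exists n => h hh; apply: polydiscD. Qed.

End Polydiscs.

Lemma nclasses_transport (T T' : Type) (E : T -> T -> Prop) (E' : T' -> T' -> Prop)
    (X : set T) (f : T -> T') n :
  (forall x y, X x -> X y -> E x y <-> E' (f x) (f y)) ->
  nclasses E' (f @` X) n -> nclasses E X n.
Proof.
move=> EE' [t [tX tI tS]].
have /choice[s sP] i : exists x, X x /\ f x = t i.
  by have [x Xx fx] := tX i; exists x.
exists s; split.
- by move=> i; case: (sP i).
- move=> i j; have [si fi] := sP i; have [sj fj] := sP j.
  by move=> /(EE' _ _ si sj); rewrite fi fj => /tI.
- move=> x Xx; have [|i xi] := tS (f x); first by exists x.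
  by exists i; have [si fi] := sP i; apply/EE' => //; rewrite fi.
Qed.

Section TopologicalGroups.
Variable G : topologicalGroupType.

Lemma continuous_mulgr (x : G) : continuous (fun y : G => (y * x)%g).
Proof.
move=> y; apply: (@continuous_comp _ _ _ (fun y : G => (y, x)) (fun z => (z.1 * z.2)%g)).
  by apply: cvg_pair => //=; exact: cvg_cst.
exact: mulg_continuous.
Qed.

Lemma open_coset (B : set G) x : open B -> open [set y | coset_eq B y x].
Proof. by move=> oB; apply: (open_comp _ oB) => y _; exact: continuous_mulgr. Qed.

Lemma open_subgroup_index (B : set G) : compact [set: G] -> open B ->
  is_subgroup B -> exists n, nclasses (coset_eq B) [set: G] n.
Proof.
move=> cG oB sB.
have [] := compact_finite_subcover (1%g : G) cG (fun x => open_coset x oB).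
  by move=> x; exists x; exact: coset_eq_refl.
move=> D DP.
have h : nclasses eq [set i | i \in D] #|{: D}|.
  apply: (nclasses_representatives (t := val)); split.
  - exact: valP.
  - by move=> i j /val_inj.
  - by move=> x xD; exists [` xD]%fset.
have /choice[f fP] x : exists i, i \in D /\ coset_eq B x i.
  by have [i] := DP x; exists i.
have [n nP _] := nclasses_exists (f := f) (E := coset_eq B) (X := setT)
  (coset_eq_refl sB) (coset_eq_sym sB) (fun x y => @esym _ x y)
  (fun x y z => @etrans _ x y z) (fun x _ => (fP x).1)
  (fun x y _ _ (e : f x = f y) => coset_eq_trans sB (fP x).2
     (eq_ind_r (fun z => coset_eq B z y) (coset_eq_sym sB (fP y).2) e)) h.
by exists n.
Qed.

End TopologicalGroups.

Section StandardGroups.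
Variables (RR : realType) (c : RR) (R : idomainType) (m : set R).
Variables (d : nat) (G : topologicalGroupType) (A : set (chart R G d)).
Hypotheses (hc : 1 < c) (idm : is_ideal m)
  (sepm : forall x, (forall n, ideal_pow m n x) -> x = 0) (hgr : graded_domain m).
Hypothesis chA : forall u, A u -> is_chart m u.
Variables (N : nat) (u : chart R G d).
Hypothesis stdu : open_standard_subgroup c m A N u.
Local Notation phi := (chart_map u).
Local Notation Gn := (natural_filtration m N u).

Let sgu : is_subgroup (chart_dom u). Proof. by case: stdu => _ _ []. Qed.

Lemma standard_mulr x x' z n : chart_dom u x -> chart_dom u x' -> chart_dom u z ->
  polydisc m n (phi x - phi x') -> polydisc m n (phi (x * z)%g - phi (x' * z)%g).
Proof.
move=> ux ux' uz xx' i; rewrite mxE [X in _ + X]mxE.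
have [_ _ _ _ [F [_ hF]]] := stdu.
have h := hF _ _ ux uz i; have h' := hF _ _ ux' uz i.
by apply: (integral_series_congr hc idm sepm hgr h h'); exact: polydisc_sub_row.
Qed.

(** Right translation by an element of S preserves congruence of coordinates at every level.
    Translating by y and by y^-1 passes between the pairs (x y^-1, 1) and (x, y), so the cosets in S
    are exactly the congruence classes of coordinates. *)
Lemma natural_filtration_quot x y n : chart_dom u x -> chart_dom u y ->
  Gn n (x * y^-1)%g <-> polydisc m (N + n) (phi x - phi y).
Proof.
move=> ux uy; have [u1 uM uV] := sgu; have [_ _ _ [_ phi1] _] := stdu.
split => [[uxy] /= h|h].
  have : polydisc m (N + n) (phi (x * y^-1)%g - phi 1%g) by rewrite phi1 subr0.
  by move/(standard_mulr uxy u1 uy); rewrite mulgVK mul1g.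
split; first by apply: uM => //; apply: uV.
have := standard_mulr ux uy (uV _ uy) h.
by rewrite mulgV phi1 subr0.
Qed.

Lemma natural_filtration_subgroup n : is_subgroup (Gn n).
Proof.
have [u1 uM uV] := sgu; have [_ _ _ [_ phi1] _] := stdu.
have Gn1 : Gn n 1%g by split=> //=; rewrite phi1; exact: polydisc0.
have GnB x y : Gn n x -> Gn n y -> Gn n (x * y^-1)%g.
  move=> [ux hx] [uy hy]; apply/natural_filtration_quot => //.
  exact: polydiscB.
have GnV x : Gn n x -> Gn n x^-1%g by move=> /(GnB _ _ Gn1); rewrite mul1g.
by split=> // x y hx /GnV /(GnB _ _ hx); rewrite invgK.
Qed.

Lemma natural_filtration_le k n : (k <= n)%N -> Gn n `<=` Gn k.
Proof.
move=> kn x [ux hx]; split => //=.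
by apply: polydisc_le hx => //; rewrite leq_add2l.
Qed.

Lemma natural_filtration_image n : phi @` Gn n = polydisc m (N + n).
Proof.
have [_ _ _ [im _] _] := stdu.
apply/seteqP; split => [_ [x [_ hx] <-]//|y hy].
have : polydisc m N y by apply: polydisc_le hy => //; exact: leq_addr.
by rewrite -im => -[x ux xy]; exists x => //; split => //=; rewrite xy.
Qed.

Lemma natural_filtration_open n : open (Gn n).
Proof.
have [_ Au _ _ _] := stdu; have [_ _ _ h] := chA Au.
apply/h; first by move=> x [].
by rewrite natural_filtration_image; exact: polydisc_adic_open.
Qed.

Lemma nclasses_natural_filtration k n a :
  nclasses (fun x y => ideal_pow m (N + n) (x - y)) (ideal_pow m (N + k)) a ->
  nclasses (coset_eq (Gn n)) (Gn k) (a ^ d).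
Proof.
move=> /(nclasses_polydisc d); rewrite -(natural_filtration_image k).
apply: nclasses_transport => x y [ux _] [uy _].
exact: natural_filtration_quot.
Qed.

Lemma natural_filtration_index (q : nat) (mu : nat -> nat) : compact [set: G] ->
  (1 < q)%N ->
  (forall n, nclasses (fun x y => ideal_pow m n.+1 (x - y)) (ideal_pow m n)
    (q ^ mu n)) ->
  exists2 g, (0 < g)%N & forall n,
    Defs.index (Gn n) = (g * q ^ (d * \sum_(N <= i < N + n) mu i))%N.
Proof.
move=> cG q1 muP.
have [g gP] := open_subgroup_index cG (natural_filtration_open 0)
  (natural_filtration_subgroup 0).
exists g.
  case: g gP => // -[t [_ _ /(_ 1%g I)[[]]]] //.
move=> n; apply: nclasses_index; first exact: natural_filtration_subgroup.
apply: nclasses_coset_mul gP _.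
- by split.
- exact: natural_filtration_subgroup.
- by [].
- exact: natural_filtration_le.
rewrite mulnC expnM; apply: nclasses_natural_filtration; rewrite addn0.
exact: nclasses_ideal_pow.
Qed.

End StandardGroups.

(** * Growth of analytic subgroups *)

Lemma nclasses_ext (T : Type) (E E' : T -> T -> Prop) (X : set T) n :
  (forall x y, X x -> X y -> E x y <-> E' x y) -> nclasses E X n -> nclasses E' X n.
Proof.
move=> EE' nE; apply: (@nclasses_transport _ _ _ E X id).
  by move=> x y Xx Xy; split => /(EE' _ _ Xx Xy).
by rewrite image_id.
Qed.

Section SubgroupGrowth.
Variables (RR : realType) (c : RR) (R : idomainType) (m : set R).
Variables (d : nat) (G : topologicalGroupType) (A : set (chart R G d)).
Hypotheses (hc : 1 < c) (idm : is_ideal m)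
  (sepm : forall x, (forall n, ideal_pow m n x) -> x = 0) (hgr : graded_domain m)
  (m_neq0 : exists2 x, x != 0 & m x).
Hypothesis atlasA : full_atlas c m A.
Variables (N : nat) (u : chart R G d).
Hypothesis stdu : open_standard_subgroup c m A N u.
Local Notation phi := (chart_map u).
Local Notation Gn := (natural_filtration m N u).

Let chA w : A w -> is_chart m w. Proof. by case: atlasA => + _ _ _; apply. Qed.

(** Both transition maps between [u] and [v] are Lipschitz near the identity. [Gn k] is chosen so
    small that both estimates hold on it, and its image under [v] contains a polydisc because the
    inverse transition is Lipschitz. *)
Lemma chart_comparison (v : chart R G d) :
  A v -> chart_dom v 1%g -> chart_map v 1%g = 0 ->
  exists k t k' : nat,
  [/\ Gn k `<=` chart_dom v,
      forall x y n, Gn k x -> Gn k y -> polydisc m (n + t) (phi x - phi y) ->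
        polydisc m n (chart_map v x - chart_map v y),
      forall x y n, Gn k x -> Gn k y ->
        polydisc m (n + t) (chart_map v x - chart_map v y) ->
        polydisc m n (phi x - phi y) &
      forall y, polydisc m k' y -> exists2 x, Gn k x & chart_map v x = y].
Proof.
move=> Av v1 psi1; set psi := chart_map v.
have [_ Au [[u1 _ _] _] [_ phi1] _] := stdu.
have [p p0 mp] := m_neq0.
have [_ _ /(_ u v Au Av)[] + + _] := atlasA.
move=> [f [af fE]] [g [ag gE]].
have fE' x : (chart_dom u `&` chart_dom v) x -> psi x = f (phi x) by move/fE.
have gE' x : (chart_dom u `&` chart_dom v) x -> phi x = g (psi x).
  by move=> [ux vx]; rewrite gE.
have D0 : (phi @` (chart_dom u `&` id @^-1` chart_dom v)) 0 by exists 1%g.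
have D'0 : (psi @` (chart_dom v `&` id @^-1` chart_dom u)) 0 by exists 1%g.
have [k1 [t1 [sub1 lip1]]] := analytic_lipschitz hc idm sepm hgr p0 mp af D0.
have [k2 [t2 [sub2 lip2]]] := analytic_lipschitz hc idm sepm hgr p0 mp ag D'0.
(* [k1] places [phi] of [Gn k] in the region where [f] is Lipschitz; [k2 + t1] places its image
   under [psi] in the region for [g]. *)
pose k := (k1 + k2 + t1)%N; pose t := (t1 + t2)%N.
have uinj : set_inj (chart_dom u) phi by case: (chA Au).
have GD x : Gn k x -> (chart_dom u `&` chart_dom v) x /\ polydisc m k1 (phi x).
  move=> [ux hx]; have hx1 : polydisc m k1 (phi x).
    by apply: polydisc_le hx => //; rewrite /k; lia.
  split => //; have [x' [ux' vx'] xx'] := sub1 _ hx1.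
  by rewrite -(uinj x' x) ?inE.
have L1 x y n : Gn k x -> Gn k y -> polydisc m (n + t) (phi x - phi y) ->
    polydisc m n (psi x - psi y).
  move=> /GD[Dx hx] /GD[Dy hy] xy; rewrite (fE' x)// (fE' y)//.
  by apply: lip1 => //; apply: polydisc_le xy => //; rewrite /t; lia.
have Gk1 : Gn k 1%g.
  by case: (natural_filtration_subgroup hc idm sepm hgr stdu k).
have P2 x : Gn k x -> polydisc m k2 (psi x).
  move=> kx; have [Dx hx] := GD _ kx; have [D1 _] := GD _ Gk1.
  rewrite -[psi x]subr0 -[0]psi1 -/psi (fE' x)// (fE' 1%g)//.
  apply: lip1 => //; first by rewrite phi1; exact: polydisc0.
  by rewrite phi1 subr0; case: kx => _; apply: polydisc_le => //; rewrite /k; lia.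
(* A point [y] of level at least [k2] comes from some [x]; [N + k] levels must be left for [phi x]
   after the loss [t]. *)
exists k, t, (N + k + t + k2)%N; split => //.
- by move=> x /GD[[]].
- move=> x y n kx ky xy; have [[ux vx] hx] := GD _ kx; have [[uy vy] hy] := GD _ ky.
  rewrite (gE' x)// (gE' y)//; apply: lip2; try exact: P2.
  by apply: polydisc_le xy => //; rewrite /t; lia.
- move=> y hy; have hy2 : polydisc m k2 y by apply: polydisc_le hy => //; lia.
  have [x [vx ux] xy] := sub2 _ hy2; exists x => //; split => //=.
  rewrite -[phi x]subr0 -[0]phi1 (gE' x)// (gE' 1%g)//.
  rewrite -/psi [psi x]xy [psi 1%g]psi1; apply: lip2 => //; first exact: polydisc0.
  by rewrite subr0; apply: polydisc_le hy => //; rewrite /t; lia.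
Qed.

Variables (q : nat) (mu : nat -> nat).
Hypotheses (q1 : (1 < q)%N) (muP : forall n,
  nclasses (fun x y => ideal_pow m n.+1 (x - y)) (ideal_pow m n) (q ^ mu n)).
Hypothesis cG : compact [set: G].
Variable H : set G.
Hypothesis anH : analytic_subgroup A H.
Local Notation len n := (\sum_(0 <= i < n) mu i)%N.

(** The two bounds on |H : H /\ Gn n| carry a shift [T] of the level and constants independent of
    [n]. The clause on points outside [H] expresses that [H] is closed, in the form used for
    compactness. *)
Lemma subgroup_growth : exists e k T C : nat,
  [/\ (e <= d)%N, (0 < C)%N,
      (forall x, ~ H x -> exists n, forall y, coset_eq (Gn n) y x -> ~ H y) &
      forall n, (k <= n)%N -> exists a,
        [/\ nclasses (coset_eq (Gn n)) H (C * a),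
            (a <= q ^ (e * len (N + n + T)))%N &
            forall j, (j + T <= N + n)%N -> (q ^ (e * len j) <= C * a * q ^ (e * len T))%N]].
Proof.
have [sgH] := anH; have [H1 HM HV] := sgH.
move=> /(_ _ H1)[v [E [Av v1 psi1 HE]]].
have [pi [b [M [b0 Epi ME piM]]]] := subspace_parametrization E.
have [k [t [k' [Gkv L1 L2 surj]]]] := chart_comparison Av v1 psi1.
set e := \dim E in pi M Epi ME piM *; set psi := chart_map v in HE psi1 L1 L2 surj *.
have vinj : set_inj (chart_dom v) psi by case: (chA Av).
have sgn := natural_filtration_subgroup hc idm sepm hgr stdu.
have quot := natural_filtration_quot hc idm sepm hgr stdu.
have HkE x : Gn k x -> H x <-> to_frac (psi x) \in E.
  move=> kx; have vx := Gkv _ kx; split => [Hx|Ex].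
    have : (psi @` (H `&` chart_dom v)) (psi x) by exists x.
    by rewrite HE => -[].
  have : (psi @` (H `&` chart_dom v)) (psi x) by rewrite HE; split => //; exists x.
  by move=> [x' [Hx' vx'] xx']; rewrite -(vinj x' x) ?inE.
pose w := adic_ord m b.
have divb n (y : 'rV[R]_e) : polydisc m (w + n) (b *: y) -> polydisc m n y.
  by move=> h i; apply: (ideal_pow_divl idm sepm hgr b0); have := h i; rewrite mxE.
have divb' n (y : 'rV[R]_d) : polydisc m (w + n) (b *: y) -> polydisc m n y.
  by move=> h i; apply: (ideal_pow_divl idm sepm hgr b0); have := h i; rewrite mxE.
have mulM n (y : 'rV[R]_e) : polydisc m n y -> polydisc m n (y *m M).
  move=> h i; rewrite mxE; apply: ideal_pow_sum => // j _.
  by apply: ideal_powMr.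
have sgHk : is_subgroup (H `&` Gn k).
  have [k1 kM kV] := sgn k; split => [|x y [Hx kx] [Hy ky]|x [Hx kx]].
  - by split.
  - by split; [exact: HM|exact: kM].
  - by split; [exact: HV|exact: kV].
have [g gP] := open_subgroup_index cG
  (natural_filtration_open idm chA stdu k) (sgn k).
(* [C] is |H : H /\ Gn k|; it is finite because the index of the open subgroup [Gn k] in G bounds
   it. *)
have [C CP _] : exists2 C, nclasses (coset_eq (H `&` Gn k)) H C & (C <= g)%N.
  apply: (nclasses_exists (f := id) _ _ _ _ _ _ gP) => //.
  - exact: coset_eq_refl.
  - exact: coset_eq_sym.
  - exact: coset_eq_sym.
  - exact: coset_eq_trans.
  - by move=> x y Hx Hy xy; split => //; apply: HM => //; exact: HV.
have C0 : (0 < C)%N by case: C CP => // -[s [_ _ /(_ 1%g H1)[[]]]].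
(* [T] collects the losses: the level [k'] of the polydisc covered by [psi], the Lipschitz loss [t],
   the order [w] of the denominator, and the level [N]. *)
exists e, k, (k' + t + w + N)%N, C; split => //.
- by have := dimvS (subvf E); rewrite dimvf dim_matrix mul1r.
(* Either the coset of [x] modulo [Gn k] misses [H], or translation by an element of [H] brings [x]
   into [Gn k], where [H] is given by linear equations. *)
- suff closed_k x : Gn k x -> ~ H x ->
      exists n, forall y, Gn k y -> coset_eq (Gn n) y x -> ~ H y.
    move=> x nHx.
    have [[h Hh hx]|nh] := pselect (exists2 h, H h & coset_eq (Gn k) h x); last first.
      by exists k => y yx Hy; apply: nh; exists y.
    have [||n nP] := closed_k (x * h^-1)%g; first exact: (coset_eq_sym (sgn k) hx).
      by move=> Hxh; apply: nHx; rewrite -[x](mulgVK h); apply: HM.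
    exists (maxn k n) => y yx Hy; apply: (nP (y * h^-1)%g).
    + apply: (coset_eq_trans (sgn k) (y := x)); last exact: (coset_eq_sym (sgn k) hx).
      by apply: natural_filtration_le yx => //; exact: leq_maxl.
    + rewrite /coset_eq mulgKA.
      by apply: natural_filtration_le yx => //; exact: leq_maxr.
    + by apply: HM => //; exact: HV.
  move=> kx nHx.
  have nEx : to_frac (psi x) \notin E by apply/negP => /(HkE _ kx).
  (* Outside [E] the equation [b *: y = mxsub id pi y *m M] fails modulo some m^j, and then it fails
     for every point congruent to [psi x] modulo m^j. *)
  have [j nj] : exists j, ~ polydisc m j (b *: psi x - mxsub id pi (psi x) *m M).
    apply: contrapT => h; move/negP: nEx; apply.
    have bx : b *: psi x = mxsub id pi (psi x) *m M.
      apply/eqP; rewrite -subr_eq0; apply/eqP/rowP => i; rewrite [RHS]mxE.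
      by apply: sepm => n; apply: contrapT => hn; apply: h; exists n => /(_ i).
    have : to_frac (b *: psi x) \in E by rewrite bx.
    rewrite /to_frac map_mxZ => /(memvZ (tofrac b)^-1).
    by rewrite scalerA mulVf ?scale1r// tofrac_eq0.
  exists (k + j + t)%N => y ky yx Hy; apply: nj.
  have : polydisc m (j + t) (phi y - phi x).
    have [ux _] := kx; have [uy _] := ky.
    by have /quot := yx; move=> /(_ uy ux); apply: polydisc_le => //; lia.
  move=> /(L1 _ _ _ ky kx) /(polydiscBC idm) xy.
  have /(HkE _ ky)/Epi by_ := Hy.
  have -> : b *: psi x - mxsub id pi (psi x) *m M =
      b *: (psi x - psi y) - mxsub id pi (psi x - psi y) *m M.
    by rewrite scalerBr linearB/= mulmxBl by_ opprB addrA subrK.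
  apply: polydiscB => //; last by apply: mulM => i; have := xy (pi i); rewrite !mxE.
  by move=> i; rewrite mxE; apply: ideal_powMl.
move=> n kn; pose X := H `&` Gn k.
(* Upper bound: on [H] the [pi]-coordinates of [psi] determine the coset. Dividing by [b] costs [w]
   levels and returning to [phi] costs [t], hence the precision [N + n + t + w]. *)
have NT : nclasses (fun x y : 'rV[R]_e => polydisc m (N + n + t + w) (x - y))
    (polydisc m 0) ((q ^ len (N + n + t + w)) ^ e).
  by apply: nclasses_polydisc; have := nclasses_ideal_pow idm muP 0 (N + n + t + w).
have hX x y : X x -> X y ->
    polydisc m (N + n + t + w) (mxsub id pi (psi x) - mxsub id pi (psi y)) ->
    coset_eq (Gn n) x y.
  move=> [Hx kx] [Hy ky] xy; have [ux _] := kx; have [uy _] := ky.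
  apply/quot => //; apply: (L2 _ _ _ kx ky); apply: divb'.
  have /(HkE _ kx)/Epi bx := Hx; have /(HkE _ ky)/Epi by_ := Hy.
  by rewrite scalerBr bx by_ -mulmxBl addnC; exact: mulM.
have [a aP ale] := nclasses_exists (coset_eq_refl (sgn n)) (@coset_eq_sym _ _ (sgn n))
   (@polydiscBC _ _ _ idm _) (@polydiscB_trans _ _ _ idm _)
   (fun x (_ : X x) i => I) hX NT.
exists a; split.
- have : nclasses (coset_eq (H `&` Gn n)) H (C * a).
    apply: (nclasses_coset_mul sgH sgHk _ _ CP).
    + by move=> x [].
    + by move=> x [Hx nx]; split => //; exact: natural_filtration_le nx.
    + apply: nclasses_ext aP => x y [Hx _] [Hy _].
      by split => [xy|[]//]; split => //; apply: HM => //; exact: HV.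
  apply: nclasses_ext => x y Hx Hy.
  by split => [[]//|xy]; split => //; apply: HM => //; exact: HV.
- apply: (leq_trans ale); rewrite -expnM mulnC leq_exp2l// leq_mul2l.
  apply/orP; right; rewrite [leqRHS](@big_cat_nat _ _ _ (N + n + t + w))//=.
    exact: leq_addr.
  lia.
move=> j jn; have a0 : (0 < a)%N.
  case: a aP {ale} => // -[s [_ _ /(_ 1%g) h]].
  by have [|[]//] := h; split => //; case: (sgn k).
(* For [j] at most [k'] the factor [q ^ (e * len T)] alone suffices. *)
have [jk|kj] := leqP j k'.
  apply: (@leq_trans (1 * q ^ (e * len (k' + t + w + N)))); last first.
    by rewrite leq_mul2r muln_gt0 C0 a0 orbT.
  rewrite mul1n leq_exp2l// leq_mul2l; apply/orP; right.
  rewrite [leqRHS](@big_cat_nat _ _ _ j)//=; first exact: leq_addr.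
  lia.
have NL : nclasses (fun x y : 'rV[R]_e => polydisc m j (x - y))
    (polydisc m k') ((q ^ \sum_(k' <= i < j) mu i) ^ e).
  apply: nclasses_polydisc; have := nclasses_ideal_pow idm muP k' (j - k').
  by rewrite subnKC// ltnW.
(* Lower bound: each parameter [y] of level [k'] gives the point of [H] with [psi]-coordinates
   [y *m M]. Its [pi]-coordinates are [b *: y], so distinct classes of [y] modulo m^j give distinct
   cosets. *)
have /choice[f fP] y : exists x, polydisc m k' y -> Gn k x /\ psi x = y *m M.
  have [hy|nhy] := pselect (polydisc m k' y); last by exists 1%g.
  by have [x kx xy] := surj _ (mulM _ _ hy); exists x.
have : ((q ^ \sum_(k' <= i < j) mu i) ^ e <= a)%N.
  apply: (nclasses_le (f := f) (@coset_eq_sym _ _ (sgn n)) (@coset_eq_trans _ _ (sgn n))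
    _ _ NL aP).
    move=> y /fP[kf fy]; split => //; apply/(HkE _ kf); rewrite fy; exact: ME.
  move=> y y' /fP[kf fy] /fP[kf' fy'] nf.
  have [uf _] := kf; have [uf' _] := kf'.
  apply: divb; rewrite scalerBr -!piM -linearB/= -fy -fy'.
  move=> i; rewrite !mxE.
  suff : polydisc m (w + j) (psi (f y) - psi (f y')).
    by move=> /(_ (pi i)); rewrite !mxE.
  apply: (L1 _ _ _ kf kf').
  move/quot : nf => /(_ uf uf'); apply: polydisc_le => //; lia.
rewrite -expnM mulnC => alow.
have -> : len j = (len k' + \sum_(k' <= i < j) mu i)%N.
  by rewrite (@big_cat_nat _ _ _ k')//= ltnW.
rewrite mulnDr expnD mulnC leq_mul//.
  by apply: (leq_trans alow); rewrite leq_pmull.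
rewrite leq_exp2l// leq_mul2l; apply/orP; right.
rewrite [leqRHS](@big_cat_nat _ _ _ k')//=; first exact: leq_addr.
lia.
Qed.

End SubgroupGrowth.

(** * Hausdorff dimension *)

Section Hausdorff.
Variables (RR : realType) (T : Type) (dist : T -> T -> RR).
Local Open Scope ereal_scope.

Lemma diameter_ge0 U : 0 <= diameter dist U.
Proof. by rewrite /diameter le_max lexx. Qed.

Lemma diameter_le U (r : RR) : (0 <= r)%R ->
  (forall x y, U x -> U y -> (dist x y <= r)%R) -> diameter dist U <= r%:E.
Proof.
move=> r0 h; rewrite /diameter ge_max lee_fin r0/=; apply: ge_ereal_sup.
by move=> _ [[x y] [/= Ux Uy] <-]; rewrite lee_fin; exact: h.
Qed.

Lemma dist_le_diameter U x y : U x -> U y -> (dist x y)%:E <= diameter dist U.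
Proof.
move=> Ux Uy; rewrite /diameter le_max; apply/orP; right.
by apply: ereal_sup_ubound; exists (x, y).
Qed.

Lemma cover_term_ge0 (s : RR) (F : nat -> set T) i :
  0 <= (if F i == set0 then 0 else poweR (diameter dist (F i)) s).
Proof. by case: ifP => // _; exact: poweR_ge0. Qed.

Lemma cover_cost_ge0 (s : RR) F : 0 <= cover_cost dist s F.
Proof. by apply: nneseries_ge0 => i _ _; exact: cover_term_ge0. Qed.

Lemma hausdorff_premeasure_ge0 (s e : RR) X : 0 <= hausdorff_premeasure dist s e X.
Proof. by apply/ereal_infP => _ [F _ <-]; exact: cover_cost_ge0. Qed.

Lemma hausdorff_measure_eq0 (s : RR) X :
  (forall e n : RR, (0 < e)%R -> (0 < n)%R -> exists F : nat -> set T,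
    [/\ X `<=` \bigcup_i F i, forall i, diameter dist (F i) <= e%:E &
        cover_cost dist s F <= n%:E]) ->
  hausdorff_measure dist s X = 0.
Proof.
move=> h; apply/eqP; rewrite eq_le; apply/andP; split; last first.
  apply: (le_trans (hausdorff_premeasure_ge0 s 1 X)).
  by apply: ereal_sup_ubound; exists 1%R => //=; exact: ltr01.
apply: ge_ereal_sup => _ [e /= e0 <-]; apply/lee_addgt0Pr => n n0.
have [F [FX Fe Fn]] := h _ _ e0 n0; rewrite add0e.
by apply: le_trans Fn; apply: ereal_inf_lbound; exists F.
Qed.

Lemma cover_cost_le (s : RR) F (a : nat) (r : RR) : (0 <= r)%R ->
  (forall i, (i < a)%N -> poweR (diameter dist (F i)) s <= r%:E) ->
  (forall i, (a <= i)%N -> F i = set0) ->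
  cover_cost dist s F <= (a%:R * r)%:E.
Proof.
move=> r0 h F0; rewrite /cover_cost (nneseries_split 0 a); last first.
  by move=> i _; exact: cover_term_ge0.
rewrite add0n [X in _ + X]eseries0 ?adde0; last first.
  by move=> i ai _; rewrite F0// eqxx.
apply: (@le_trans _ _ (\sum_(0 <= i < a) r%:E)).
  rewrite big_nat [leRHS]big_nat; apply: lee_sum => i ia.
  by case: ifP => [_|_]; [rewrite lee_fin|exact: h].
by rewrite sumEFin lee_fin sumr_const_nat subn0 mulr_natl.
Qed.

End Hausdorff.

Section FiltrationDistance.
Variables (RR : realType) (G : groupType) (Gn : nat -> set G).
Hypotheses (sgn : forall n, is_subgroup (Gn n))
  (Gn_le : forall k n, (k <= n)%N -> Gn n `<=` Gn k)
  (index_gt0 : forall n, (0 < Defs.index (Gn n))%N)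
  (index_le : forall k n, (k <= n)%N -> (Defs.index (Gn k) <= Defs.index (Gn n))%N).
Local Notation dist := (filtration_dist RR Gn).
Local Notation radius n := ((Defs.index (Gn n))%:R^-1 : RR).

Lemma radius_gt0 n : 0 < radius n.
Proof. by rewrite invr_gt0 ltr0n. Qed.

Lemma radius_le k n : (k <= n)%N -> radius n <= radius k.
Proof. by move=> kn; rewrite lef_pV2 ?posrE ?ltr0n// ler_nat index_le. Qed.

Lemma filtration_dist_le n x y : coset_eq (Gn n) x y -> dist x y <= radius n.
Proof.
move=> xy; rewrite /filtration_dist; case: asboolP => [_|[]]; last by exists n.
apply: ge_inf; last by exists n.
by exists 0 => _ [k _ <-]; exact/ltW/radius_gt0.
Qed.

(** Outside [Gn n] the quotient lies only in terms of index below [n], all of radius larger than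
    [r]. The condition [r < 1] excludes the default distance 1 of points whose quotient lies in no
    term. *)
Lemma coset_eq_of_dist (r : RR) n x y : r < 1 ->
  (forall k, (k < n)%N -> r < radius k) -> dist x y <= r -> coset_eq (Gn n) x y.
Proof.
move=> r1 nmin; rewrite /filtration_dist; case: asboolP => [[k kxy]|_]; last first.
  by move=> /le_lt_trans/(_ r1); rewrite ltxx.
move=> hr; apply: contrapT => nxy.
have lt_n j : Gn j (x * y^-1)%g -> (j < n)%N.
  by move=> jxy; rewrite ltnNge; apply/negP => /Gn_le/(_ _ jxy).
have n0 : (n.-1 < n)%N by have := lt_n _ kxy; case: n {nmin nxy lt_n}.
have : radius n.-1 <= r.
  apply: le_trans hr; apply: lb_le_inf; first by exists (radius k), k.
  by move=> _ [j /= /lt_n jn <-]; apply: radius_le; lia.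
by rewrite leNgt nmin.
Qed.

Lemma hausdorff_measure_upper (s : RR) (H : set G) : 0 <= s ->
  (forall e : RR, 0 < e -> exists n a,
    [/\ nclasses (coset_eq (Gn n)) H a, radius n <= e & a%:R * radius n `^ s <= e]) ->
  hausdorff_measure dist s H = 0%E.
Proof.
move=> s0 h; apply: hausdorff_measure_eq0 => e r e0 r0.
have [|n [a [[t [tH tI tS]] ne nr]]] := h (Num.min e r); first by rewrite lt_min e0.
move: ne nr; rewrite !le_min => /andP[ne _] /andP[_ nr].
pose F i := if insub i is Some j then [set y | coset_eq (Gn n) y (t j)] else set0.
have diamF i : (diameter dist (F i) <= (radius n)%:E)%E.
  apply: diameter_le => [|x y]; first exact/ltW/radius_gt0.
  rewrite /F; case: insubP => // j _ _ /= xt yt; apply: filtration_dist_le.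
  exact: (coset_eq_trans (sgn n) xt (coset_eq_sym (sgn n) yt)).
exists F; split.
- by move=> x /tS[j xj]; exists j => //; rewrite /F valK.
- by move=> i; apply: le_trans (diamF i) _; rewrite lee_fin.
- apply: (@le_trans _ _ (a%:R * radius n `^ s)%:E); last by rewrite lee_fin.
  apply: cover_cost_le; first exact: powR_ge0.
    move=> i _; rewrite -poweR_EFin; apply: gt0_ler_poweR => //.
      by rewrite in_itv/= diameter_ge0 leey.
    by rewrite in_itv/= leey lee_fin ltW// radius_gt0.
  by move=> i ai; rewrite /F insubF// ltnNge ai.
Qed.

End FiltrationDistance.

(** The set bounds |H /\ B : H /\ C| from below. Fixing [j0] in it, the products of t_j t_j0^-1, an
    element of [B], with the representatives of the [B]-classes are pairwise inequivalent modulo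
    [C]. *)
Lemma ball_count (G : groupType) (H B C : set G) (a b : nat) (t : 'I_a -> G) x :
  is_subgroup H -> is_subgroup B -> is_subgroup C -> C `<=` B ->
  representatives (coset_eq C) H t -> nclasses (coset_eq B) H b ->
  (#|[set j | `[< coset_eq B (t j) x >]]%SET| * b <= a)%N.
Proof.
move=> sgH sgB sgC CB [tH tI tS] [s [sH sI _]]; have [H1 HM HV] := sgH.
set J := [set j | _]%SET.
have [->|[j0 j0J]] := set_0Vmem J; first by rewrite cards0.
have JP (j : {j | j \in J}) : coset_eq B (t (val j)) x.
  by case: j => j /=; rewrite inE => /asboolP.
have j0P : coset_eq B (t j0) x := JP (exist _ j0 j0J).
pose y (z : {j | j \in J} * 'I_b) := (t (val z.1) * (t j0)^-1 * s z.2)%g.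
have /choice[g gP] z : exists i, coset_eq C (y z) (t i).
  by apply: tS; apply: (HM) => //; apply: (HM) => //; exact: HV.
have tj0 j : B (t (val (j : {j | j \in J})) * (t j0)^-1)%g.
  exact: (coset_eq_trans sgB (JP j) (coset_eq_sym sgB j0P)).
suff ginj : injective g.
  have := leq_card _ ginj; rewrite card_prod !card_ord card_sig.
  by congr (_ * _ <= _)%N; apply: eq_card => j.
move=> [j l] [j' l'] e.
have yy : coset_eq C (y (j, l)) (y (j', l')).
  have h1 := gP (j, l); have h2 := gP (j', l'); rewrite -e in h2.
  exact: (coset_eq_trans sgC h1 (coset_eq_sym sgC h2)).
have ll' : l = l'.
  apply: sI; have [_ BM BV] := sgB.
  have := BM _ _ (BM _ _ (BV _ (tj0 j)) (CB _ yy)) (tj0 j').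
  rewrite /coset_eq /y /=; move: (t _ * _)%g (t (val j') * _)%g => z z'.
  by rewrite (invgM z') -!mulgA mulKg mulVg mulg1.
rewrite -ll' in yy *; move: yy; rewrite /coset_eq /y/= mulgKA mulgKA.
by move/tI/val_inj => ->.
Qed.

Section LowerBound.
Variables (RR : realType) (G : topologicalGroupType) (Gn : nat -> set G).
Hypotheses (sgn : forall n, is_subgroup (Gn n))
  (Gn_le : forall k n, (k <= n)%N -> Gn n `<=` Gn k)
  (Gn_open : forall n, open (Gn n))
  (index_gt0 : forall n, (0 < Defs.index (Gn n))%N)
  (index_le : forall k n, (k <= n)%N -> (Defs.index (Gn k) <= Defs.index (Gn n))%N)
  (cG : compact [set: G]).
Local Notation dist := (filtration_dist RR Gn).
Local Notation radius n := ((Defs.index (Gn n))%:R^-1 : RR).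
Hypothesis radius0 : forall e : RR, 0 < e -> exists n, radius n <= e.
Variables (H : set G) (h : nat -> nat).
Hypotheses (sgH : is_subgroup H)
  (clH : forall x, ~ H x -> exists n, forall y, coset_eq (Gn n) y x -> ~ H y)
  (hP : forall n, nclasses (coset_eq (Gn n)) H (h n)).

Lemma nclasses_subgroup_gt0 n : (0 < h n)%N.
Proof.
have [H1 _ _] := sgH; have := hP n.
by case: (h n) => // -[t [_ _ /(_ 1%g H1)[[]]]].
Qed.

(** 1 / h n plays the part of the Haar measure of H /\ Gn n. It is replaced by counting cosets at
    one level below all those of the cover, for which the sum of the [l i] serves. *)
Lemma finite_cover_sum (M : nat) (Q : pred nat) (l : nat -> nat) (x : nat -> G) :
  (forall y, H y -> exists2 i, (i < M)%N && Q i & coset_eq (Gn (l i)) y (x i)) ->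
  1 <= \sum_(i < M | Q i) (h (l i))%:R^-1 :> RR.
Proof.
move=> cov; pose n := (\sum_(i < M) l i)%N.
have ln (i : 'I_M) : (l i <= n)%N by rewrite /n (bigD1 i)//= leq_addr.
have [t tP] := hP n; have [tH tI tS] := tP.
pose J i := [set j | `[< coset_eq (Gn (l i)) (t j) (x i) >]]%SET.
have hJ : (h n <= \sum_(i < M | Q i) #|J i|)%N.
  apply: (@leq_trans #|\bigcup_(i < M | Q i) J i|%SET); last first.
    elim/big_ind2 : _ => [|A a B b Aa Bb|//]; first by rewrite cards0.
    by rewrite (leq_trans _ (leq_add Aa Bb))// -cardsUI leq_addr.
  rewrite -[X in (X <= _)%N]card_ord -cardsT; apply/subset_leq_card/fintype.subsetP.
  move=> j _; have [i /andP[iM Qi] ji] := cov _ (tH j).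
  by apply/bigcupP; exists (Ordinal iM) => //; rewrite inE; exact/asboolP.
have hn : 0 < (h n)%:R :> RR by rewrite ltr0n nclasses_subgroup_gt0.
rewrite -(ler_pM2l hn) mulr1 mulr_sumr.
apply: (@le_trans _ _ (\sum_(i < M | Q i) #|J i|)%:R); first by rewrite ler_nat.
rewrite natr_sum; apply: ler_sum => i _.
rewrite ler_pdivlMr ?ltr0n ?nclasses_subgroup_gt0// -natrM ler_nat.
exact: (ball_count (x i) sgH (sgn (l i)) (sgn n) (Gn_le (ln i)) tP (hP (l i))).
Qed.

Variables (s K : RR).
Hypotheses (s_gt0 : 0 < s) (K_gt0 : 0 < K)
  (hK : forall n, 1 <= K * (h n)%:R * radius n `^ s).

(** Mass distribution: [hK] bounds the mass 1 / h n of a ball by K times its radius to the power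
    [s]. Enlarging the sets of the cover may use at most half of the total mass 1, whence the factor
    2. The bound 1/2 on diameters keeps the enlarged ones below 1, where [coset_eq_of_dist]
    applies. *)
Lemma cover_cost_lower (F : nat -> set G) : H `<=` \bigcup_i F i ->
  (forall i, (diameter dist (F i) <= 2^-1%:E)%E) ->
  (((2 * K)^-1)%:E <= cover_cost dist s F)%E.
Proof.
move=> HF dF.
pose r i : RR := fine (diameter dist (F i)).
have dE i : diameter dist (F i) = (r i)%:E.
  rewrite fineK// ge0_fin_numE ?diameter_ge0//.
  by rewrite (le_lt_trans (dF i))// ltey.
have r0 i : 0 <= r i by rewrite -lee_fin -dE diameter_ge0.
have r2 i : r i <= 2^-1 by rewrite -lee_fin -dE.
(* Sets of diameter 0 must be enlarged to fit in a ball: radius at least e i. *)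
have eP i : exists e : RR, [/\ 0 < e, e <= 2^-1 & e `^ s <= (2 * K)^-1 * 2^-1 ^+ i.+1].
  pose b : RR := (2 * K)^-1 * 2^-1 ^+ i.+1.
  have b0 : 0 < b by rewrite mulr_gt0 ?invr_gt0 ?mulr_gt0 ?exprn_gt0 ?invr_gt0.
  have [e0 e2] : 0 < Num.min 2^-1 (b `^ s^-1) /\ Num.min 2^-1 (b `^ s^-1) <= 2^-1.
    by split; [rewrite lt_min invr_gt0 ltr0n powR_gt0|rewrite ge_min lexx].
  exists (Num.min 2^-1 (b `^ s^-1)); split => //.
  apply: (@le_trans _ _ ((b `^ s^-1) `^ s)).
    apply: ge0_ler_powR; rewrite ?nnegrE ?powR_ge0//; [exact: ltW|exact: ltW|].
    by rewrite ge_min lexx orbT.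
  by rewrite -powRrM mulVf ?gt_eqF// powRr1// ltW.
have {eP} /choice[e eP] := eP.
pose del i := Num.max (r i) (e i).
have del0 i : 0 < del i by rewrite lt_max; case: (eP i) => ->; rewrite orbT.
have del1 i : del i < 1.
  rewrite (@le_lt_trans _ _ 2^-1)// ?invf_lt1 ?ltr1n//.
  by rewrite ge_max r2; case: (eP i).
(* The least level of radius at most [del i]: its ball contains [F i], and its radius is comparable
   from above with [del i]. *)
have /choice[l lP] i : exists n, radius n <= del i /\
    forall k, (k < n)%N -> del i < radius k.
  have ex : exists n, radius n <= del i by exact: radius0.
  case: (ex_minnP ex) => n nP nmin; exists n; split => // k kn.
  by rewrite ltNge; apply/negP => /nmin; rewrite leqNgt kn.
have /choice[x xP] i : exists x, F i !=set0 -> F i x.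
  have [[x Fx]|n0] := pselect (F i !=set0); first by exists x.
  by exists 1%g => /n0.
pose Q i := F i != set0.
have FB i y : F i y -> coset_eq (Gn (l i)) y (x i).
  move=> Fy; have Fx : F i (x i) by apply: xP; exists y.
  have [_ lmin] := lP i.
  apply: (coset_eq_of_dist (r := del i) Gn_le index_gt0 index_le) => //.
  rewrite le_max -lee_fin -dE; apply/orP; left; exact: dist_le_diameter.
(* Each z outside the closed set H gets a neighbourhood avoiding H. *)
pose f (z : nat + G) := match z with
  | inl i => if Q i then [set y | coset_eq (Gn (l i)) y (x i)] else set0
  | inr z => \bigcup_(n in [set n | forall y, coset_eq (Gn n) y z -> ~ H y])
       [set y | coset_eq (Gn n) y z] end.
have [] := compact_finite_subcover (1%g : G) (f := f) cG.
- case=> [i|z] /=; first by case: ifP => _; [exact: open_coset|exact: open0].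
  by apply: bigcup_open => n _; exact: open_coset.
- move=> y; have [Hy|nHy] := pselect (H y).
    have [i _ Fiy] := HF _ Hy; exists (inl i) => /=.
    have -> : Q i by apply/set0P; exists y.
    exact: FB.
  have [n nP] := clH nHy; exists (inr y); exists n => //.
  exact: coset_eq_refl.
move=> D DP.
pose M := (\sum_(z <- D) if z is inl i then i.+1 else 0)%N.
have DM i : inl i \in D -> (i < M)%N.
  by move=> iD; rewrite /M (big_fsetD1 _ iD)/= addSn ltnS leq_addr.
have cov y : H y -> exists2 i, (i < M)%N && Q i & coset_eq (Gn (l i)) y (x i).
  move=> Hy; have [[i|z] zD] := DP y => /=; last first.
    by move=> [n nP yn]; case: (nP _ yn).
  by case: ifP => // Qi yi; exists i => //; rewrite DM.
have := finite_cover_sum cov.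
have h1 : \sum_(i < M | Q i) (h (l i))%:R^-1 <=
    K * \sum_(i < M | Q i) (r i `^ s + e i `^ s).
  rewrite mulr_sumr; apply: ler_sum => i _.
  have hl : 0 < (h (l i))%:R :> RR by rewrite ltr0n nclasses_subgroup_gt0.
  rewrite -[leLHS]mul1r ler_pdivrMr// mulrAC.
  apply: (le_trans (hK (l i))); rewrite ler_pM2l ?mulr_gt0//.
  apply: (@le_trans _ _ (del i `^ s)).
    apply: ge0_ler_powR; rewrite ?nnegrE ?invr_ge0 ?ler0n//; [exact: ltW|exact: ltW|].
    by case: (lP i).
  by rewrite /del maxEle; case: ifP => _; rewrite ?lerDl ?lerDr ?powR_ge0.
move=> /le_trans/(_ h1); rewrite big_split/= mulrDr => h2.
have h3 : K * \sum_(i < M | Q i) e i `^ s <= 2^-1.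
  apply: (@le_trans _ _ (K * \sum_(i < M) (2 * K)^-1 * 2^-1 ^+ i.+1)).
    rewrite ler_pM2l// big_mkcond/=; apply: ler_sum => i _.
    have [_ _ ei] := eP i; case: ifP => // _; apply: le_trans ei.
    exact: powR_ge0.
  have K2 : K * (2 * K)^-1 = 2^-1 by rewrite invfM mulrCA mulfV ?mulr1 ?gt_eqF.
  rewrite -mulr_sumr mulrA K2.
  have -> : \sum_(i < M) 2^-1 ^+ i.+1 = 1 - 2^-1 ^+ M :> RR.
    elim: M {h2 h1 DM cov} => [|k IHk]; first by rewrite big_ord0 expr0 subrr.
    rewrite big_ord_recr/= IHk exprS; lra.
  by rewrite ler_piMr// gerBl exprn_ge0// invr_ge0.
have h4 : 2^-1 <= K * \sum_(i < M | Q i) r i `^ s by lra.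
apply: le_trans (nneseries_lim_ge M _); last first.
  by move=> i _ _; exact: cover_term_ge0.
apply: (@le_trans _ _ (\sum_(i < M | Q i) r i `^ s)%:E).
  by rewrite lee_fin invfM ler_pdivrMr// mulrC.
rewrite big_mkord -sumEFin big_mkcond/=; apply: lee_sum => i _.
by rewrite /Q; case: ifP => Fi; case: ifP => Fi'; rewrite ?dE ?poweR_EFin//; move: Fi; rewrite Fi'.
Qed.

Lemma hausdorff_measure_lower : hausdorff_measure dist s H <> 0%E.
Proof.
move=> h0; have : (((2 * K)^-1)%:E <= hausdorff_measure dist s H)%E.
  apply: (@le_trans _ _ (hausdorff_premeasure dist s 2^-1 H)).
    by apply/ereal_infP => _ [F [HF dF] <-]; exact: cover_cost_lower.
  by apply: ereal_sup_ubound; exists 2^-1 => //=; rewrite invr_gt0.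
by rewrite h0 lee_fin leNgt invr_gt0 mulr_gt0.
Qed.

End LowerBound.

(** The enlargement argument takes s-th roots and requires s > 0. At s = 0 any nonempty set of a
    cover costs 1, even if its diameter is 0. *)
Lemma hausdorff_measure0_neq0 (RR : realType) (T : Type) (dist : T -> T -> RR)
    (X : set T) : X !=set0 -> hausdorff_measure dist 0 X <> 0%E.
Proof.
move=> [x Xx] h0; have : (1%:E <= hausdorff_measure dist 0 X)%E.
  apply: (@le_trans _ _ (hausdorff_premeasure dist 0 1 X)); last first.
    by apply: ereal_sup_ubound; exists 1 => //=; exact: ltr01.
  apply/ereal_infP => _ [F [XF _] <-]; have [i _ Fx] := XF _ Xx.
  have F0 j := cover_term_ge0 dist 0 F j.
  apply: le_trans (nneseries_lim_ge i.+1 _); last by move=> j _ _; exact: F0.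
  rewrite big_nat_recr//=; have /set0P/negbTE-> : F i !=set0 by exists x.
  by rewrite poweRe0 leeDr// sume_ge0.
by rewrite h0 lee_fin ler10.
Qed.

(** * The dimension of an analytic subgroup *)

Section HausdorffDimension.
Variables (RR : realType) (c : RR) (R : idomainType) (m : set R).
Variables (d : nat) (G : topologicalGroupType) (A : set (chart R G d)).
Hypotheses (hc : 1 < c) (idm : is_ideal m)
  (sepm : forall x, (forall n, ideal_pow m n x) -> x = 0) (hgr : graded_domain m)
  (m_neq0 : exists2 x, x != 0 & m x) (d_gt0 : (0 < d)%N)
  (noeth : noetherian R) (maxm : maximal_ideal m) (finm : finite_set (residues m)).
Hypothesis atlasA : full_atlas c m A.
Hypothesis cG : compact [set: G].
Variables (N : nat) (u : chart R G d).
Hypothesis stdu : open_standard_subgroup c m A N u.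
Local Notation Gn := (natural_filtration m N u).
Local Notation radius n := ((Defs.index (Gn n))%:R^-1 : RR).
Variable H : set G.
Hypothesis anH : analytic_subgroup A H.

Lemma analytic_subgroup_hDim :
  exists2 e, (e <= d)%N & hDim RR Gn H = (e%:R / d%:R)%:E.
Proof.
have [q [S [mu [q1 muP muS]]]] := hilbert_function noeth maxm finm.
have mu0 n := mu_gt0 idm muP n sepm m_neq0.
pose l n := (\sum_(0 <= i < n) mu i)%N.
have lN a b : l (a + b) = (l a + \sum_(a <= i < a + b) mu i)%N.
  by rewrite /l (@big_cat_nat _ _ _ a)//= leq_addr.
have l_ge a b : (b <= \sum_(a <= i < a + b) mu i)%N.
  rewrite -[X in (X <= _)%N]mul1n.
  have {1}-> : b = (a + b - a)%N by rewrite addKn.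
  by rewrite mulnC -sum_nat_const_nat leq_sum.
have chA w : A w -> is_chart m w by case: atlasA => + _ _ _; apply.
have sgn := natural_filtration_subgroup hc idm sepm hgr stdu.
have Gnle := natural_filtration_le (N := N) (u := u) idm.
have Gnop := natural_filtration_open idm chA stdu.
have [g g0 ind] := natural_filtration_index hc idm sepm hgr chA stdu cG q1 muP.
have ind0 n : (0 < Defs.index (Gn n))%N.
  by rewrite ind muln_gt0 g0 expn_gt0 (ltnW q1).
have indle k n : (k <= n)%N -> (Defs.index (Gn k) <= Defs.index (Gn n))%N.
  move=> kn; rewrite !ind leq_mul2l; apply/orP; right.
  rewrite leq_exp2l// leq_mul2l; apply/orP; right.
  rewrite [leqRHS](@big_cat_nat _ _ _ (N + k)) ?leq_add2l ?leq_addr//=.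
have ind_ge n : (n <= Defs.index (Gn n))%N.
  rewrite ind; apply: (@leq_trans (q ^ (d * \sum_(N <= i < N + n) mu i))).
    apply/ltnW/(leq_trans (ltn_expl n q1)); rewrite leq_exp2l//.
    by rewrite (leq_trans (l_ge N n))// leq_pmull.
  by rewrite leq_pmull.
have rad0 (e : RR) : 0 < e -> exists n, radius n <= e.
  move=> e0; exists (Num.truncn e^-1).+1.
  rewrite invf_ple ?posrE ?ltr0n//.
  by rewrite (le_trans (ltW (truncnS_gt _)))// ler_nat.
have [e [k [T [C [ed C0 clH grH]]]]] :=
  subgroup_growth hc idm sepm hgr m_neq0 atlasA stdu q1 muP cG anH.
have [sgH _] := anH.
exists e => //.
have hsub n : exists a, nclasses (coset_eq (Gn n)) H a.
  have [a aP] := open_subgroup_index cG (Gnop n) (sgn n).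
  have [b bP _] := nclasses_subset (coset_eq_refl (sgn n)) (@coset_eq_sym _ _ (sgn n))
    (@coset_eq_trans _ _ (sgn n)) (fun x (_ : H x) => I) aP.
  by exists b.
have /choice[h hP] := hsub.
have hE n a : nclasses (coset_eq (Gn n)) H a -> h n = a.
  move=> aP; apply: nclasses_uniq (hP n) aP.
    exact: coset_eq_sym.
  exact: coset_eq_trans.
(* In logarithms the estimates become linear in the lengths [l]. *)
pose L : RR := ln q%:R.
have L0 : 0 < L by rewrite ln_gt0// ltr1n.
have expq n : (q ^ n)%:R = expR (L * n%:R) :> RR.
  by rewrite natrX expRM_natr lnK// posrE ltr0n (ltnW q1).
have radE n s : radius n `^ s =
    expR (- s * (ln g%:R + L * d%:R * ((l (N + n)%N)%:R - (l N)%:R))).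
  rewrite /powR gt_eqF ?invr_gt0 ?ltr0n//; congr expR.
  rewrite lnV ?posrE ?ltr0n// mulrN mulNr; congr (- (_ * _)).
  rewrite ind natrM lnM ?posrE ?ltr0n ?expn_gt0 ?(ltnW q1)//; congr (_ + _).
  by rewrite expq expRK lN !natrD natrM mulrA addrAC subrr add0r.
have lng : 0 <= ln g%:R :> RR by rewrite ln_ge0// ler1n.
have d0 : 0 < d%:R :> RR by rewrite ltr0n.
have upper (s : RR) : e%:R / d%:R < s -> hausdorff_measure (filtration_dist RR Gn) s H = 0%E.
  rewrite ltr_pdivrMr// => es.
  have s0 : 0 < s.
    by rewrite -(pmulr_lgt0 _ d0) (le_lt_trans _ es)// ler0n.
  apply: (hausdorff_measure_upper (RR := RR)) => //; first exact: ltW.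
  (* The slack [sg] is split in two: [K] is chosen so that half of it pays for the shifted tail [y],
     and [n2] so that the other half pays for the constants gathered in [B]. *)
  move=> eps eps0; pose sg := s * d%:R - e%:R.
  have sg0 : 0 < sg by rewrite subr_gt0.
  pose K := (Num.truncn (2 * e%:R / sg)).+1.
  have Ksg : 2 * e%:R <= K%:R * sg.
    by rewrite -ler_pdivrMr// ltW// truncnS_gt.
  have [n0 slow] := sum_mu_slow muS T K.
  pose B := ln C%:R + s * L * d%:R * (l N)%:R - ln eps.
  have [n1 n1P] := rad0 _ eps0.
  pose n2 := (Num.truncn (B / (L * sg / 2))).+1.
  have n2P : B <= L * sg / 2 * n2%:R.
    by rewrite mulrC -ler_pdivrMr ?divr_gt0 ?mulr_gt0// ltW// truncnS_gt.
  have [n [kn n0n n1n n2n]] : exists n, [/\ (k <= n)%N, (n0 <= n)%N, (n1 <= n)%N & (n2 <= n)%N].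
    by exists (k + n0 + n1 + n2)%N; split; clear; lia.
  have [a [aP ale _]] := grH n kn.
  exists n, (C * a)%N; split => //.
    apply: le_trans n1P; rewrite lef_pV2 ?posrE ?ltr0n// ler_nat.
    exact: indle.
  set x := l (N + n); pose y := (\sum_(N + n <= i < N + n + T) mu i)%N.
  have Kyx : (K * y <= x)%N by apply/slow/(leq_trans n0n)/leq_addl.
  have nx : (n <= x)%N.
    by apply: leq_trans (leq_addl N n) _; have := l_ge 0%N (N + n)%N; rewrite add0n.
  have Ca : (C * a)%:R <= expR (ln C%:R + L * (e%:R * (x%:R + y%:R))) :> RR.
    rewrite expRD lnK ?posrE ?ltr0n// -natrD -natrM -expq -natrM ler_nat.
    by rewrite leq_mul2l -lN ale orbT.
  rewrite radE; apply: (le_trans (ler_wpM2r (expR_ge0 _) Ca)).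
  rewrite -expRD -[leRHS]lnK// ler_expR -/x.
  have Kyx' : K%:R * y%:R <= x%:R :> RR by rewrite -natrM ler_nat.
  have nx' : n2%:R <= x%:R :> RR.
    by rewrite ler_nat (leq_trans n2n).
  have h1 : 2 * e%:R * y%:R <= sg * x%:R.
    apply: (@le_trans _ _ (K%:R * sg * y%:R)); first by rewrite ler_wpM2r.
    by rewrite mulrAC mulrC ler_wpM2l// ltW.
  have h2 : L * sg / 2 * n2%:R <= L * sg / 2 * x%:R.
    by rewrite ler_wpM2l// ltW// divr_gt0 ?mulr_gt0.
  have h3 : L * (2 * e%:R * y%:R) <= L * (sg * x%:R) by rewrite ler_wpM2l// ltW.
  have h4 : 0 <= s * ln g%:R by rewrite mulr_ge0// ltW.
  move: n2P h2 h3; rewrite /B /sg; lra.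
have lower (s : RR) : 0 < s -> s < e%:R / d%:R ->
    hausdorff_measure (filtration_dist RR Gn) s H <> 0%E.
  move=> s0; rewrite ltr_pdivlMr// => se.
  pose ta := e%:R - s * d%:R.
  have ta0 : 0 < ta by rewrite subr_gt0.
  pose K := (Num.truncn (s * d%:R / ta)).+1.
  have Kta : s * d%:R <= K%:R * ta.
    by rewrite -ler_pdivrMr// ltW// truncnS_gt.
  have [n0 slow] := sum_mu_slow muS T K.
  have [n1 [kn1 Tn1]] : exists n1, (k <= n1)%N /\ (T + n0 <= n1)%N.
    by exists (k + T + n0)%N; split; clear; lia.
  (* [K1] serves for n >= n1, where the growth estimate applies. [K2] serves for the finitely many n
     < n1, where h n >= 1 and the radius is at least that of [n1]. *)
  pose K1 := expR (L * (e%:R * (l T)%:R) + s * ln g%:R).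
  pose K2 := (radius n1 `^ s)^-1.
  have K10 : 0 < K1 by exact: expR_gt0.
  have rad_gt0 n : 0 < radius n `^ s by rewrite powR_gt0// invr_gt0 ltr0n.
  have K20 : 0 < K2 by rewrite invr_gt0.
  have hgt0 n : (0 < h n)%N := nclasses_subgroup_gt0 sgH hP n.
  have K12 : 0 < K1 + K2 by rewrite addr_gt0.
  apply: (hausdorff_measure_lower sgn Gnle Gnop ind0 indle cG rad0 sgH clH hP s0 K12).
  move=> n; have [nn1|n1n] := ltnP n n1.
    have h1 : radius n1 `^ s <= radius n `^ s.
      apply: ge0_ler_powR; rewrite ?nnegrE ?invr_ge0 ?ler0n//; first exact: ltW.
      by rewrite lef_pV2 ?posrE ?ltr0n// ler_nat; apply: indle; exact: ltnW.
    apply: (@le_trans _ _ (K2 * 1 * radius n1 `^ s)).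
      by rewrite mulr1 /K2 mulVf ?lt0r_neq0.
    apply: ler_pM h1; rewrite ?powR_ge0 ?mulr_ge0 ?ler01 ?(ltW K20)//.
    by apply: ler_pM; rewrite ?ler01 ?ler1n ?lerDr ?(ltW K20) ?(ltW K10).
  have [a [aP _ alow]] := grH n (leq_trans kn1 n1n).
  have := alow (N + n - T)%N; set j := (N + n - T)%N.
  have [jT n0j] : (N + n = j + T)%N /\ (n0 <= j)%N.
    by move: (leq_trans Tn1 n1n); rewrite /j; clear; lia.
  rewrite jT leqnn => /(_ isT); rewrite -(hE _ _ aP) -/(l j) -/(l T) => hlow.
  pose y := (\sum_(j <= i < j + T) mu i)%N.
  have Ky : (K * y <= l j)%N by exact: slow.
  have hlow' : expR (L * (e%:R * (l j)%:R)) <=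
      (h n)%:R * expR (L * (e%:R * (l T)%:R)).
    by rewrite -!natrM -!expq -natrM ler_nat.
  apply: (@le_trans _ _ (K1 * (h n)%:R * radius n `^ s)); last first.
    by rewrite ler_wpM2r ?powR_ge0// ler_wpM2r// lerDl ltW.
  have -> : K1 * (h n)%:R * radius n `^ s = expR (s * ln g%:R) *
      ((h n)%:R * expR (L * (e%:R * (l T)%:R))) * radius n `^ s.
    by rewrite /K1 expRD; ring.
  apply: (@le_trans _ _
      (expR (s * ln g%:R) * expR (L * (e%:R * (l j)%:R)) * radius n `^ s)); last first.
    by rewrite ler_wpM2r ?powR_ge0// ler_wpM2l// expR_ge0.
  rewrite radE jT lN -/y.
  rewrite -!expRD -[leLHS]expR0 ler_expR natrD.
  have Ky' : K%:R * y%:R <= (l j)%:R :> RR by rewrite -natrM ler_nat.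
  have h1 : s * d%:R * y%:R <= ta * (l j)%:R.
    apply: (@le_trans _ _ (K%:R * ta * y%:R)); first by rewrite ler_wpM2r.
    by rewrite mulrAC mulrC ler_wpM2l// ltW.
  have h3 : L * (s * d%:R * y%:R) <= L * (ta * (l j)%:R) by rewrite ler_wpM2l// ltW.
  have h4 : 0 <= s * L * d%:R * (l N)%:R by rewrite !mulr_ge0 ?ler0n// ltW.
  move: h3; rewrite /ta; lra.
apply/eqP; rewrite eq_le; apply/andP; split.
  apply/lee_addgt0Pr => eps eps0; apply: ereal_inf_lbound.
  exists (e%:R / d%:R + eps) => //; split => /=.
    by rewrite addr_ge0 ?divr_ge0 ?ler0n// ltW.
  by apply: upper; rewrite ltrDl.
apply/ereal_infP => _ [s [s0 ms] <-]; rewrite lee_fin leNgt; apply/negP => se.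
move: s0; rewrite le_eqVlt => /orP[/eqP s0|s0]; last exact: (lower s).
move: ms; rewrite -s0; apply: hausdorff_measure0_neq0.
by case: sgH => H1 _ _; exists 1%g.
Qed.

End HausdorffDimension.

(** For d = 0 or m = 0 the standard subgroup would be trivial; being open in a compact group it has
    finite index, so G would be finite. *)
Lemma polydisc_nontrivial (RR : realType) (c : RR) (R : idomainType) (m : set R)
    (d : nat) (G : topologicalGroupType) (A : set (chart R G d)) (N : nat)
    (u : chart R G d) :
  is_ideal m -> (forall x, (forall n, ideal_pow m n x) -> x = 0) ->
  graded_domain m -> 1 < c -> (forall w, A w -> is_chart m w) ->
  open_standard_subgroup c m A N u -> compact [set: G] -> infinite_set [set: G] ->
  ~ (polydisc m N `<=` [set (0 : 'rV[R]_d)]).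
Proof.
move=> idm sepm hgr hc chA stdu cG infG triv; apply: infG.
have [_ Au [[u1 _ _] ou] [im phi1] _] := stdu; have [_ _ uinj _] := chA _ Au.
have sgu : is_subgroup (chart_dom u) by case: stdu => _ _ [].
have u1E x : chart_dom u x -> x = 1%g.
  move=> ux; apply: uinj; rewrite ?inE// phi1.
  by apply: triv; rewrite -im; exists x.
have [g [t [_ _ tS]]] := open_subgroup_index cG ou sgu.
apply: (@sub_finite_set _ _ (t @` setT)); last exact/finite_image/finite_finset.
move=> x _; have [i /u1E/eqP] := tS x I.
by rewrite divg_eq1 => /eqP ->; exists i.
Qed.

Theorem corollary3p4 (RR : realType) (c : RR) (p : nat) (R : idomainType)
    (m : set R) (d : nat) (G : topologicalGroupType) (A : set (chart R G d))
    (hc : 1 < c) (hR : pro_p_ring p m) (hgr : graded_domain m)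
    (hG : analytic_group c m A) (hprof : profinite_group G)
    (hinf : infinite_set [set: G]) :
  analytic_spectrum c m A `<=`
    [set (k%:R / d%:R : RR)%:E | k in [set k : nat | (k <= d)%N]] /\
  finite_set (analytic_spectrum c m A) /\
  (forall h, analytic_spectrum c m A h -> exists q : rat, h = (ratr q : RR)%:E).
Proof.
have [noeth [maxm _] [sepm _] finm _] := hR; have [idm _ _] := maxm.
have [atlasA _ _] := hG; have [cG _ _] := hprof.
have spec : analytic_spectrum c m A `<=`
    [set (k%:R / d%:R : RR)%:E | k in [set k : nat | (k <= d)%N]].
  move=> _ [H anH [N [u [stdu ->]]]].
  have chA w : A w -> is_chart m w by case: atlasA => + _ _ _; apply.
  have nontriv : ~ (polydisc m N `<=` [set (0 : 'rV[R]_d)]).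
    by move/(polydisc_nontrivial idm sepm hgr hc chA stdu cG hinf).
  have N0 : (0 < N)%N by case: stdu.
  have d0 : (0 < d)%N.
    rewrite lt0n; apply/eqP => d0; apply: nontriv => x _; apply/rowP => i.
    by have := ltn_ord i; rewrite [X in (_ < X)%N]d0.
  have m0 : exists2 x, x != 0 & m x.
    apply: contrapT => nm; apply: nontriv => x xN; apply/rowP => i.
    rewrite mxE; apply: contrapT => /eqP xi; apply: nm; exists (x 0 i) => //.
    by apply/(ideal_pow1 idm)/(ideal_pow_le idm N0).
  have [e ed ->] := analytic_subgroup_hDim hc idm sepm hgr m0 d0 noeth maxm finm
    atlasA cG stdu anH.
  by exists e.
split => //; split.
  apply: sub_finite_set spec _; apply: finite_image.
  by apply: (sub_finite_set _ (finite_II d.+1)) => k /=; rewrite ltnS.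
move=> h /spec[k _ <-]; exists (k%:R / d%:R).
by rewrite fmorph_div/= !ratr_nat.
Qed.
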